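(* Let $2<p<\infty$, let $f\in L^p_{\mathbb C}$ be real-valued and let $\psi=(\xi,\eta)\in L^p_{\mathbb C}$, with $\|\psi\|_p=\|f\|_p=1$. Let $P_\psi:[-1,1]\to\mathbb R$ be given by $P_\psi(\varepsilon)=\|f+\varepsilon\psi\|_p^2$. Then for $\varepsilon\in[-1,1]$ $$\left|P_\psi(\varepsilon)-1-2\langle f|f|^{p-2},\xi\rangle_{L^2}\,\varepsilon-\langle\mathcal L_{f,p}\psi,\psi\rangle_{L^2\oplus L^2}\,\varepsilon^2\right|\le\kappa_p|\varepsilon|^{\beta_p},$$ where $\mathcal L_{f,p}=\mathcal L_{f,p}^{Re}\oplus\mathcal L_{f,p}^{Im}$ is given by $$\mathcal L_{f,p}^{Re}\xi=-(p-2)\left(\int f|f|^{p-2}\xi\right)f|f|^{p-2}+(p-1)|f|^{p-2}\xi,\qquad \mathcal L_{f,p}^{Im}\eta=|f|^{p-2}\eta,$$ and $$\beta_p=\begin{cases}3&\text{if }p\ge4\\ 1+\frac p2&\text{if }2<p\le4,\end{cases}\qquad \kappa_p=\begin{cases}\frac43(5p^2-12p+7)&\text{if }p\ge4\\ \frac{16(p-1)}{p(p+2)}\left[4(p-2)+\left(\frac{3p}{p-2}\right)^{\frac p2-1}\right]&\text{if }2<p\le4.\end{cases}$$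
   Context: All $L^p$ spaces are over a fixed measure space. $L^p$ denotes the real-valued functions and $L^p_{\mathbb C}=L^p\oplus L^p$ the complex-valued functions; $\psi=(\xi,\eta)$ means $\psi=\xi+i\eta$ with $\xi,\eta$ real-valued, and $\|\psi\|_p=(\int|\psi|^p)^{1/p}$ with $|\psi|^2=\xi^2+\eta^2$. The pairings are $\langle g,h\rangle_{L^2}=\int gh$ and $\langle\mathcal L_{f,p}\psi,\psi\rangle_{L^2\oplus L^2}=\int(\mathcal L^{Re}_{f,p}\xi)\,\xi+\int(\mathcal L^{Im}_{f,p}\eta)\,\eta$. *)

(* Defs.v *)
From HB Require Import structures.
From mathcomp Require Import all_boot all_order all_algebra.
From mathcomp Require Import all_classical all_reals all_analysis.
Set Implicit Arguments.
Unset Strict Implicit.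
Unset Printing Implicit Defensive.
Import Order.TTheory GRing.Theory Num.Theory.
Import numFieldNormedType.Exports.
Local Open Scope classical_set_scope.
Local Open Scope ring_scope.

(* A complex-valued function psi = xi + i eta is the pair (xi, eta) of its real
   and imaginary parts.  Addition and real scaling of such pairs are those of
   the product lmodType, so [(f, 0) + eps *: psi] is the function f + eps psi
   when f is real-valued. *)

Section ComplexLp.
Context d (T : measurableType d) (R : realType).
Variables (mu : {measure set T -> \bar R}) (p : R).
Implicit Types (f g h xi eta : T -> R) (psi phi : (T -> R) * (T -> R)).

Definition LpC : set ((T -> R) * (T -> R)) :=
  [set psi | psi.1 \in Lfun mu p%:E /\ psi.2 \in Lfun mu p%:E].

Definition modulus psi (x : T) : R := Num.sqrt (psi.1 x ^+ 2 + psi.2 x ^+ 2).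

(* [fine] loses nothing on [LpC], where the extended-real norm is finite. *)
Definition normC psi : R := fine ('N[mu]_p%:E[EFin \o modulus psi])%E.

Definition pairing g h : R := \int[mu]_x (g x * h x).

Definition pairingC phi psi : R := pairing phi.1 psi.1 + pairing phi.2 psi.2.

(* f |f|^(p-2); it vanishes where f does, since 0 `^ r = 0 for r != 0. *)
Definition duality f : T -> R := fun x => f x * `|f x| `^ (p - 2).

Definition Lre f xi : T -> R := fun x =>
  - (p - 2) * (\int[mu]_y (duality f y * xi y)) * duality f x
  + (p - 1) * `|f x| `^ (p - 2) * xi x.

Definition Lim f eta : T -> R := fun x => `|f x| `^ (p - 2) * eta x.

Definition Lop f psi : (T -> R) * (T -> R) := (Lre f psi.1, Lim f psi.2).

Definition Ppsi f psi (eps : R) : R := normC ((f, 0) + eps *: psi) ^+ 2.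

End ComplexLp.

Definition beta {R : realType} (p : R) : R :=
  if 4 <= p then 3 else 1 + p / 2.

(* The two cases of the constant overlap at p = 4, where they give the different
   values 52 and 28; [is_kappa p k] says that k is a value given by one of the
   cases that apply to p.  (The two cases of [beta] agree at p = 4.) *)
Definition is_kappa {R : realType} (p k : R) : Prop :=
  (4 <= p /\ k = 4 / 3 * (5 * p ^+ 2 - 12 * p + 7)) \/
  (2 < p <= 4 /\
   k = 16 * (p - 1) / (p * (p + 2)) *
       (4 * (p - 2) + (3 * p / (p - 2)) `^ (p / 2 - 1))).

(* Main.v *)
(* Write p = 2m, a = int f|f|^(p-2) xi, L = <L_f psi, psi>, Q = int |f + eps psi|^p
   and P = Q^(1/m), which is to be compared with P0 = 1 + 2 a eps + L eps^2.
   Pointwise, |f + eps psi|^p differs from its second order Taylor polynomial in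
   eps by a multiple of |eps psi|^q (|f| + |eps psi|)^(p-q), with q = 3 if p >= 4 and
   q = 1 + p/2 if p <= 4; by homogeneity this is a statement about |1 + z|^p,
   and, since |1 + z|^2 = 1 + u with u = 2 Re z + |z|^2, about powers of the
   reals 1 + u and 1 + |z|.  Young's inequality integrates the error to a
   multiple of |eps|^q (1 + |eps|)^(p-q).  For small eps the expansion of Q gives
   a bound on |P^m - P0^m|, hence on |P - P0|, because both P and P0 are at
   least (1 - |eps|)^2.  For larger eps it is enough to use the first order bounds
   0 <= P - 1 - 2 a eps <= (p-1) eps^2 (1 + |eps|)^(p-2) and 0 <= L <= p - 1,
   and, when p >= 4 and (p-1)|eps| >= 5/6, the triangle inequality. *)

Require Import Defs.
From HB Require Import structures.
From mathcomp Require Import all_boot all_order all_algebra.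
From mathcomp Require Import all_classical all_reals all_analysis.
From mathcomp Require Import measurable_realfun ring lra.
Set Implicit Arguments.
Unset Strict Implicit.
Unset Printing Implicit Defensive.
Import Order.TTheory GRing.Theory Num.Theory.
Import numFieldNormedType.Exports.
Local Open Scope classical_set_scope.
Local Open Scope ring_scope.

(** * Taylor estimates for real powers *)

Section PowerTaylor.
Context {R : realType}.
Implicit Types (a b c k m p x y u w : R).

(** Young's inequality requires an error exponent 0 < q < p: q = 3 violates this for p <= 3, while q
    = 1 + p/2 satisfies it for every p > 2. It is applied to |psi| and to the mean (|f| + |eps|
    |psi|) / (1 + |eps|), both of p-norm at most 1, so that integration does not worsen the scalar
    constant. The lower bound P >= (1 + eps a)^2 is Hoelder's inequality tested against f |f|^(p-2).
    Since a^2 <= L, also P0 = (1 + eps a)^2 + (L - a^2) eps^2 >= (1 + eps a)^2. Both quantities thus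
    stay away from 0 for small eps, where the m-th root is Lipschitz. The prescribed constants leave
    little slack, and for p >= 4 the argument has to be uniform in p. This is why eps is measured
    there by (p-1) |eps|, and why powers (1 + z)^k are bounded through k z alone, by 1 / (1 - k z).
    The cut points 1/4, 9/20 and 5/6 are values from which a cruder bound fits under kappa. *)

Lemma is_derive_le (f df : R -> R) a b : a <= b ->
  (forall x, a <= x <= b -> is_derive x 1 f (df x)) ->
  (forall x, a <= x <= b -> 0 <= df x) -> f a <= f b.
Proof.
move=> ab fdf df0.
have d x : x \in `]a, b[%R -> is_derive x 1 f (df x).
  by rewrite in_itv/= => /andP[ax xb]; apply: fdf; rewrite !ltW.
have cf : {within `[a, b], continuous f}.
  by apply: derivable_within_continuous => x; rewrite in_itv/= => /fdf[].
have [c] := MVT_segment ab d cf.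
rewrite in_itv/= => cab /eqP; rewrite subr_eq => /eqP ->.
by rewrite ler_wpDl// mulr_ge0 ?df0// subr_ge0.
Qed.

Lemma is_derive_cubic_powR c3 c2 c1 c k x : 0 < x ->
  is_derive x 1
    (fun y => c3 * (y - 1) ^+ 3 + c2 * (y - 1) ^+ 2 + c1 * (y - 1) + c * y `^ k)
    (3 * c3 * (x - 1) ^+ 2 + 2 * c2 * (x - 1) + c1 + c * (k * x `^ (k - 1))).
Proof.
move=> x0; pose X : R -> R := id - cst 1.
have dX : is_derive x 1 X (1 - 0).
  exact: is_deriveB (is_derive_id _ _) (is_derive_cst _ _ _).
have d := is_deriveD (is_deriveD (is_deriveD (is_deriveZ c3 (is_deriveX 3 dX))
  (is_deriveZ c2 (is_deriveX 2 dX))) (is_deriveZ c1 dX))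
  (is_deriveZ c (is_derive1_powR k x0)).
apply: is_derive_eq.
rewrite subr0 /GRing.scale/= (_ : X x = x - 1)// expr1; ring.
Qed.

(* The Taylor estimates at 1 below all say that such a function is monotone. *)
Lemma cubic_powR_le c3 c2 c1 c k a b : 0 < a -> a <= b ->
  (forall x, a <= x <= b ->
    0 <= 3 * c3 * (x - 1) ^+ 2 + 2 * c2 * (x - 1) + c1 + c * (k * x `^ (k - 1))) ->
  c3 * (a - 1) ^+ 3 + c2 * (a - 1) ^+ 2 + c1 * (a - 1) + c * a `^ k <=
  c3 * (b - 1) ^+ 3 + c2 * (b - 1) ^+ 2 + c1 * (b - 1) + c * b `^ k.
Proof.
move=> a0 ab.
apply: (@is_derive_le
  (fun y => c3 * (y - 1) ^+ 3 + c2 * (y - 1) ^+ 2 + c1 * (y - 1) + c * y `^ k)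
  _ _ _ ab) => x /andP[ax _].
exact/is_derive_cubic_powR/(lt_le_trans a0).
Qed.

Lemma powR_ge1 x k : 1 <= x -> 0 <= k -> 1 <= x `^ k.
Proof. by move=> x1 k0; rewrite -[leLHS](powRr0 x) ler_powR. Qed.

Lemma powR_le1 x k : 0 < x <= 1 -> 0 <= k -> x `^ k <= 1.
Proof. by move=> x1 k0; rewrite -[leRHS](powRr0 x) ger_powR. Qed.

Lemma powR_ge1_neg x k : 0 < x <= 1 -> k <= 0 -> 1 <= x `^ k.
Proof. by move=> x1 k0; rewrite -[leLHS](powRr0 x) ger_powR. Qed.

Lemma powR_le1_neg x k : 1 <= x -> k <= 0 -> x `^ k <= 1.
Proof. by move=> x1 k0; rewrite -[leRHS](powRr0 x) ler_powR. Qed.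

(** These are the exponents of convexity. The negative ones serve to bound powers of 1 + z from
    above, in [powR1D_mul_le1]. *)
Lemma powR_ge_tangent x k : 0 < x -> 1 <= k \/ k <= 0 ->
  1 + k * (x - 1) <= x `^ k.
Proof.
move=> x0 hk; have [x1|/ltW x1] := leP 1 x.
  have /(_ _)/wrap[y /andP[y1 _]|] := @cubic_powR_le 0 0 (- k) 1 k 1 x ltr01 x1; last first.
    rewrite powR1; lra.
  case: hk => hk.
    have : 1 <= y `^ (k - 1) by apply: powR_ge1 => //; lra.
    nra.
  have : y `^ (k - 1) <= 1 by apply: powR_le1_neg => //; lra.
  nra.
have /(_ _)/wrap[y /andP[y0 y1]|] := @cubic_powR_le 0 0 k (-1) k x 1 x0 x1; last first.
  rewrite powR1; lra.
have y01 : 0 < y <= 1 by rewrite y1 (lt_le_trans x0).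
case: hk => hk.
  have : y `^ (k - 1) <= 1 by apply: powR_le1 => //; lra.
  nra.
have : 1 <= y `^ (k - 1) by apply: powR_ge1_neg => //; lra.
nra.
Qed.

Lemma powR_le_tangent x k : 0 < x -> 0 <= k <= 1 ->
  x `^ k <= 1 + k * (x - 1).
Proof.
move=> x0 /andP[k0 k1]; have [x1|/ltW x1] := leP 1 x.
  have /(_ _)/wrap[y /andP[y1 _]|] := @cubic_powR_le 0 0 k (-1) k 1 x ltr01 x1; last first.
    rewrite powR1; lra.
  have : y `^ (k - 1) <= 1 by apply: powR_le1_neg => //; lra.
  nra.
have /(_ _)/wrap[y /andP[y0 y1]|] := @cubic_powR_le 0 0 (-k) 1 k x 1 x0 x1; last first.
  rewrite powR1; lra.
have y01 : 0 < y <= 1 by rewrite y1 (lt_le_trans x0).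
have : 1 <= y `^ (k - 1) by apply: powR_ge1_neg => //; lra.
nra.
Qed.

(** Start of a climb in the order: the derivative of the gap in the estimate of order n at exponent
    k is k times the gap of order n - 1 at exponent k - 1, with the same power of [b]. *)
Lemma powR_first_order_le x b k : 1 <= k -> 1 <= x <= b ->
  x `^ k <= 1 + k * (x - 1) * b `^ (k - 1).
Proof.
move=> k1 /andP[x1 xb].
have /(_ _)/wrap[y /andP[y1 yx]|] :=
  @cubic_powR_le 0 0 (k * b `^ (k - 1)) (-1) k 1 x ltr01 x1; last first.
  rewrite powR1; lra.
have : y `^ (k - 1) <= b `^ (k - 1).
  by rewrite ge0_ler_powR ?nnegrE; lra.
nra.
Qed.

Lemma powR_second_order_le x b k : 2 <= k -> 1 <= x <= b ->
  x `^ k <= 1 + k * (x - 1) + k * (k - 1) / 2 * (x - 1) ^+ 2 * b `^ (k - 2).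
Proof.
move=> k2 /andP[x1 xb].
have /(_ _)/wrap[y /andP[y1 yx]|] :=
  @cubic_powR_le 0 (k * (k - 1) / 2 * b `^ (k - 2)) k (-1) k 1 x ltr01 x1; last first.
  rewrite powR1; lra.
have : y `^ (k - 1) <= 1 + (k - 1) * (y - 1) * b `^ (k - 1 - 1).
  by apply: powR_first_order_le; lra.
rewrite (_ : k - 1 - 1 = k - 2); last by ring.
nra.
Qed.

Lemma powR_third_order_le x b k : 3 <= k -> 1 <= x <= b ->
  x `^ k <= 1 + k * (x - 1) + k * (k - 1) / 2 * (x - 1) ^+ 2
    + k * (k - 1) * (k - 2) / 6 * (x - 1) ^+ 3 * b `^ (k - 3).
Proof.
move=> k3 /andP[x1 xb].
have /(_ _)/wrap[y /andP[y1 yx]|] :=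
  @cubic_powR_le (k * (k - 1) * (k - 2) / 6 * b `^ (k - 3)) (k * (k - 1) / 2)
    k (-1) k 1 x ltr01 x1; last first.
  rewrite powR1; lra.
have : y `^ (k - 1) <= 1 + (k - 1) * (y - 1)
    + (k - 1) * (k - 1 - 1) / 2 * (y - 1) ^+ 2 * b `^ (k - 1 - 2).
  by apply: powR_second_order_le; lra.
rewrite (_ : k - 1 - 2 = k - 3); last by ring.
nra.
Qed.

Lemma powR_second_order_le_left x k : 2 <= k -> 0 < x <= 1 ->
  x `^ k <= 1 + k * (x - 1) + k * (k - 1) / 2 * (x - 1) ^+ 2.
Proof.
move=> k2 /andP[x0 x1].
have /(_ _)/wrap[y /andP[y0 y1]|] :=
  @cubic_powR_le 0 (- (k * (k - 1) / 2)) (- k) 1 k x 1 x0 x1; last first.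
  rewrite powR1; lra.
have : 1 + (k - 1) * (y - 1) <= y `^ (k - 1).
  by apply: powR_ge_tangent; [exact: lt_le_trans y0|lra].
nra.
Qed.

Lemma powR_third_order_ge_left x k : 3 <= k -> 0 < x <= 1 ->
  1 + k * (x - 1) + k * (k - 1) / 2 * (x - 1) ^+ 2
    + k * (k - 1) * (k - 2) / 6 * (x - 1) ^+ 3 <= x `^ k.
Proof.
move=> k3 /andP[x0 x1].
have /(_ _)/wrap[y /andP[y0 y1]|] :=
  @cubic_powR_le (k * (k - 1) * (k - 2) / 6) (k * (k - 1) / 2) k (-1) k x 1 x0 x1; last first.
  rewrite powR1; lra.
have : y `^ (k - 1) <= 1 + (k - 1) * (y - 1) + (k - 1) * (k - 1 - 1) / 2 * (y - 1) ^+ 2.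
  apply: powR_second_order_le_left; first by lra.
  by rewrite y1 (lt_le_trans x0).
nra.
Qed.

Lemma powR_second_order_ge_right01 x k : 0 <= k <= 1 -> 1 <= x ->
  1 + k * (x - 1) + k * (k - 1) / 2 * (x - 1) ^+ 2 <= x `^ k.
Proof.
move=> /andP[k0 k1] x1.
have /(_ _)/wrap[y /andP[y1 _]|] :=
  @cubic_powR_le 0 (- (k * (k - 1) / 2)) (- k) 1 k 1 x ltr01 x1; last first.
  rewrite powR1; lra.
have : 1 + (k - 1) * (y - 1) <= y `^ (k - 1).
  by apply: powR_ge_tangent; lra.
nra.
Qed.

Lemma powR_second_order_le_left01 x k : 0 <= k <= 1 -> 0 < x <= 1 ->
  x `^ k <= 1 + k * (x - 1) + k * (k - 1) / 2 * (x - 1) ^+ 2.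
Proof.
move=> /andP[k0 k1] /andP[x0 x1].
have /(_ _)/wrap[y /andP[y0 y1]|] :=
  @cubic_powR_le 0 (- (k * (k - 1) / 2)) (- k) 1 k x 1 x0 x1; last first.
  rewrite powR1; lra.
have : 1 + (k - 1) * (y - 1) <= y `^ (k - 1).
  by apply: powR_ge_tangent; [exact: lt_le_trans y0|lra].
nra.
Qed.

Lemma powR_third_order_ge_right12 x m : 1 <= m <= 2 -> 1 <= x ->
  1 + m * (x - 1) + m * (m - 1) / 2 * (x - 1) ^+ 2
    - m * (m - 1) * (2 - m) / 6 * (x - 1) ^+ 3 <= x `^ m.
Proof.
move=> /andP[m1 m2] x1.
have /(_ _)/wrap[y /andP[y1 _]|] :=
  @cubic_powR_le (m * (m - 1) * (2 - m) / 6) (- (m * (m - 1) / 2)) (- m) 1 m 1 x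
    ltr01 x1; last first.
  rewrite powR1; lra.
have : 1 + (m - 1) * (y - 1) + (m - 1) * (m - 1 - 1) / 2 * (y - 1) ^+ 2 <= y `^ (m - 1).
  by apply: powR_second_order_ge_right01; lra.
nra.
Qed.

Lemma powR_second_order_le_right12 x m : 1 <= m <= 2 -> 1 <= x ->
  x `^ m <= 1 + m * (x - 1) + m * (m - 1) / 2 * (x - 1) ^+ 2.
Proof.
move=> /andP[m1 m2] x1.
have /(_ _)/wrap[y /andP[y1 _]|] :=
  @cubic_powR_le 0 (m * (m - 1) / 2) m (-1) m 1 x ltr01 x1; last first.
  rewrite powR1; lra.
have : y `^ (m - 1) <= 1 + (m - 1) * (y - 1) by apply: powR_le_tangent; lra.
nra.
Qed.

Lemma powR_second_order_ge_left12 x m : 1 <= m <= 2 -> 0 <= x <= 1 ->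
  1 + m * (x - 1) + m * (m - 1) / 2 * (x - 1) ^+ 2 <= x `^ m.
Proof.
move=> /andP[m1 m2] /andP[]; rewrite le_eqVlt => /predU1P[<- _|x0 x1].
  rewrite powR0; [nra|lra].
have /(_ _)/wrap[y /andP[y0 y1]|] :=
  @cubic_powR_le 0 (m * (m - 1) / 2) m (-1) m x 1 x0 x1; last first.
  rewrite powR1; lra.
have : y `^ (m - 1) <= 1 + (m - 1) * (y - 1).
  by apply: powR_le_tangent; [exact: lt_le_trans y0|lra].
nra.
Qed.

(** Obtained by multiplying the second order bound for [x] to the power m - 1 by x = 1 + (x - 1),
    not by differentiation. The cubic coefficient exceeds the Taylor one because the bound must
    reach x = 0, where it is an equality. *)
Lemma powR_third_order_le_left12 x m : 1 <= m <= 2 -> 0 <= x <= 1 ->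
  x `^ m <= 1 + m * (x - 1) + m * (m - 1) / 2 * (x - 1) ^+ 2
    + (m - 1) * (2 - m) / 2 * (1 - x) ^+ 3.
Proof.
move=> /andP[m1 m2] /andP[]; rewrite le_eqVlt => /predU1P[<- _|x0 x1].
  rewrite powR0; lra.
have : x `^ (m - 1) <= 1 + (m - 1) * (x - 1) + (m - 1) * (m - 1 - 1) / 2 * (x - 1) ^+ 2.
  by apply: powR_second_order_le_left01; lra.
rewrite -(@mulr_powRB1 _ x m (ltW x0)); last by lra.
move=> /(ler_wpM2l (ltW x0)); lra.
Qed.

(** Split off one factor 1 + x and use the tangent bound at exponent m - 1. For x <= 1 the excess (m
    - 1) x^2 is at most x^m; for x >= 1 factoring out x first exchanges the roles of 1 and x. *)
Lemma powRD1_le x m : 1 <= m <= 2 -> 0 < x ->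
  (1 + x) `^ m <= 1 + m * x + x `^ m.
Proof.
move=> /andP[m1 m2] x0.
rewrite -(@mulr_powRB1 _ (1 + x) m); [|lra|lra].
have [x1|/ltW x1] := leP x 1.
  have : (1 + x) `^ (m - 1) <= 1 + (m - 1) * (1 + x - 1) by apply: powR_le_tangent; lra.
  have : x ^+ 2 <= x `^ m.
    by rewrite -(powR_mulrn 2 (ltW x0)); apply: ger_powR; rewrite ?x0.
  nra.
have -> : 1 + x = x * (1 + x^-1) by field; lra.
have x10 : 0 < x^-1 by rewrite invr_gt0.
have xx : x * x^-1 = 1 by rewrite mulfV//; lra.
rewrite powRM; [|exact: ltW|lra].
have h : (1 + x^-1) `^ (m - 1) <= 1 + (m - 1) * (1 + x^-1 - 1).
  by apply: powR_le_tangent; lra.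
have a0 : 0 <= x `^ (m - 1) by exact: powR_ge0.
have ax : x `^ (m - 1) <= x by rewrite -[leRHS](powRr1 (ltW x0)) ler_powR; lra.
rewrite -(@mulr_powRB1 _ x m); [|lra|lra].
set A := x `^ (m - 1) in a0 ax *; set B := _ `^ (m - 1) in h *.
have ax1 : A * x^-1 <= 1 by rewrite ler_pdivrMr// mul1r.
rewrite mulrDr xx mulr1 mulrA.
have h1 : (x + 1) * A * B <= (x + 1) * A * (1 + (m - 1) * (1 + x^-1 - 1)).
  by rewrite ler_wpM2l// mulr_ge0//; lra.
apply: (le_trans h1).
have -> : (x + 1) * A * (1 + (m - 1) * (1 + x^-1 - 1)) =
  (x + 1) * A + (m - 1) * A * (x * x^-1) + (m - 1) * (A * x^-1) by ring.
rewrite xx; nra.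
Qed.

Lemma powR_tangent x y m : 1 <= m -> 0 <= x -> 0 <= y ->
  x `^ m + m * x `^ (m - 1) * (y - x) <= y `^ m.
Proof.
move=> m1; rewrite le_eqVlt => /predU1P[<-|x0] y0.
  rewrite powR0; last by lra.
  (* For m = 1 the slope is 0^0 = 1 and the tangent is y itself; for m > 1 the slope vanishes. *)
  rewrite add0r subr0; have [->|m1'] := eqVneq m 1.
    by rewrite subrr powRr0 powRr1// !mul1r.
  rewrite powR0 ?mulr0 ?mul0r ?powR_ge0//; by rewrite subr_eq0.
move: y0; rewrite le_eqVlt => /predU1P[<-|y0].
  rewrite powR0; last by lra.
  rewrite -(@mulr_powRB1 _ x m); [|lra|lra].
  have := powR_ge0 x (m - 1); have := mulr_ge0 (ltW x0) (powR_ge0 x (m - 1)).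
  nra.
have z0 : 0 < y / x by rewrite divr_gt0.
have := @powR_ge_tangent _ m z0 (or_introl m1).
have -> : y `^ m = x `^ m * (y / x) `^ m.
  by rewrite -powRM ?ltW// mulrCA mulfV ?mulr1//; lra.
move=> /(ler_wpM2l (powR_ge0 x m)); apply: le_trans.
rewrite -(@mulr_powRB1 _ x m); [|lra|lra].
rewrite le_eqVlt; apply/orP; left; apply/eqP; field; lra.
Qed.
End PowerTaylor.

(** * Expansion of |1 + z|^p *)

Section Modulus.
Context {R : realType}.
Implicit Types (m p rho xi x y : R).

Lemma powR_sqr x m : (x ^+ 2) `^ m = `|x| `^ (2 * m).
Proof. by rewrite powRrM powR_mulrn ?normr_ge0// real_normK ?num_real. Qed.

(* [1 + 2 * xi + rho ^+ 2] is |1 + z|^2 for z of real part xi and modulus rho. *)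
Lemma modulus_powR_chord m rho xi : 1 <= m -> `|xi| <= rho ->
  2 * rho * (1 + 2 * xi + rho ^+ 2) `^ m <=
  (rho + xi) * (1 + rho) `^ (2 * m) + (rho - xi) * `|1 - rho| `^ (2 * m).
Proof.
move=> m1; rewrite ler_norml => /andP[xi1 xi2].
have rho0 : 0 <= 1 + rho by lra.
rewrite -[in X in _ * X + _](ger0_norm rho0) -!powR_sqr.
set y := 1 + 2 * xi + rho ^+ 2.
have y0 : 0 <= y by rewrite /y; have := sqr_ge0 (1 - rho); lra.
(* At fixed rho, [y] is affine in [xi], so the claim is convexity of the power between z = - rho and
   z = rho. The tangents at [y] are weighted by rho + xi and rho - xi, for which their linear terms
   cancel. *)
have h1 := powR_tangent m1 y0 (sqr_ge0 (1 + rho)).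
have h2 := powR_tangent m1 y0 (sqr_ge0 (1 - rho)).
have {}h1 : (rho + xi) * (y `^ m + m * y `^ (m - 1) * ((1 + rho) ^+ 2 - y)) <=
  (rho + xi) * ((1 + rho) ^+ 2) `^ m by rewrite ler_wpM2l//; lra.
have {}h2 : (rho - xi) * (y `^ m + m * y `^ (m - 1) * ((1 - rho) ^+ 2 - y)) <=
  (rho - xi) * ((1 - rho) ^+ 2) `^ m by rewrite ler_wpM2l//; lra.
apply: le_trans (lerD h1 h2).
rewrite le_eqVlt; apply/orP; left; apply/eqP; rewrite /y; ring.
Qed.

(** By the chord bound only z = rho and z = - rho matter. There the bounds are 1 + 2 m rho + K and 1
    - 2 m rho + K with a common K, and they interpolate to 1 + 2 m xi + K. *)
Lemma modulus_powR_first_order m rho xi : 1 <= m -> `|xi| <= rho ->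
  (1 + 2 * xi + rho ^+ 2) `^ m - 1 - 2 * m * xi <=
  m * (2 * m - 1) * (rho ^+ 2 * (1 + rho) `^ (2 * m - 2)).
Proof.
move=> m1 hxi; have [rho0|rho0] := eqVneq rho 0.
  move: hxi; rewrite rho0 normr_le0 => /eqP ->.
  by rewrite expr0n /= mul0r !mulr0 !addr0 powR1 subrr subr0.
have {}rho0 : 0 < rho by rewrite lt_def rho0 (le_trans _ hxi).
have h1 : (1 + rho) `^ (2 * m) <= 1 + 2 * m * rho +
    m * (2 * m - 1) * (rho ^+ 2 * (1 + rho) `^ (2 * m - 2)).
  have := @powR_second_order_le _ (1 + rho) (1 + rho) (2 * m); lra.
have E1 : 1 <= (1 + rho) `^ (2 * m - 2) by apply: powR_ge1; lra.
have h2 : `|1 - rho| `^ (2 * m) <= 1 - 2 * m * rho +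
    m * (2 * m - 1) * (rho ^+ 2 * (1 + rho) `^ (2 * m - 2)).
  have [r1|r1] := ltP rho 1.
    have r10 : 0 < 1 - rho by lra.
    rewrite gtr0_norm//.
    have h : (1 - rho) `^ (2 * m) <= 1 + 2 * m * (1 - rho - 1)
        + 2 * m * (2 * m - 1) / 2 * (1 - rho - 1) ^+ 2.
      by apply: powR_second_order_le_left; lra.
    have h' : m * (2 * m - 1) * rho ^+ 2 <=
        m * (2 * m - 1) * (rho ^+ 2 * (1 + rho) `^ (2 * m - 2)).
      by rewrite ler_wpM2l ?ler_peMr ?sqr_ge0// mulr_ge0//; lra.
    lra.
  rewrite distrC ger0_norm ?subr_ge0//.
  have [->|rn1] := eqVneq rho 1.
    rewrite subrr powR0; last by lra.
    have E2 : 0 <= (1 + 1) `^ (2 * m - 2) - 1 :> R.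
      by rewrite subr_ge0; apply: powR_ge1; lra.
    have : 0 <= m * (2 * m - 1) * ((1 + 1) `^ (2 * m - 2) - 1).
      by rewrite mulr_ge0// mulr_ge0//; lra.
    have : 0 <= (2 * m - 1) * (m - 1) by rewrite mulr_ge0//; lra.
    rewrite expr1n; lra.
  have {rn1}r1 : 1 < rho by rewrite lt_def rn1.
  have r10 : 0 < rho - 1 by lra.
  have -> : (rho - 1) `^ (2 * m) = (rho - 1) ^+ 2 * (rho - 1) `^ (2 * m - 2).
    rewrite -powR_mulrn ?ltW// -powRD; first by congr (_ `^ _); ring.
    by rewrite (gt_eqF r10) implybT.
  have h : (rho - 1) `^ (2 * m - 2) <= (1 + rho) `^ (2 * m - 2).
    by rewrite ge0_ler_powR ?nnegrE; lra.
  set E := (1 + rho) `^ _ in E1 h *.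
  have h' : (rho - 1) ^+ 2 * (rho - 1) `^ (2 * m - 2) <= (rho - 1) ^+ 2 * E.
    by rewrite ler_wpM2l// sqr_ge0.
  apply: (le_trans h').
  (* Since E >= 1, it suffices that the coefficient of E dominates 2 m rho - 1 >= 0. *)
  have k1 : 2 * m * rho - 1 <= (m * (2 * m - 1) * rho ^+ 2 - (rho - 1) ^+ 2).
    have : 0 <= (m - 1) * (2 * m + 1) * (rho * (rho - 1)) by rewrite !mulr_ge0//; lra.
    have : 0 <= (m - 1) * (2 * m - 1) * rho by rewrite !mulr_ge0//; lra.
    nra.
  have k2 : 0 <= 2 * m * rho - 1 by nra.
  nra.
have := modulus_powR_chord m1 hxi.
move: hxi; rewrite ler_norml => /andP[xi1 xi2].
set K := m * (2 * m - 1) * _ in h1 h2 *.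
have {}h1 : (rho + xi) * (1 + rho) `^ (2 * m) <= (rho + xi) * (1 + 2 * m * rho + K).
  by rewrite ler_wpM2l//; lra.
have {}h2 : (rho - xi) * `|1 - rho| `^ (2 * m) <= (rho - xi) * (1 - 2 * m * rho + K).
  by rewrite ler_wpM2l//; lra.
move=> h; rewrite -(@ler_pM2l _ (2 * rho)); last by lra.
lra.
Qed.

Lemma modulus_powR_second_order_ge4 m rho xi : 2 <= m -> `|xi| <= rho ->
  `|(1 + 2 * xi + rho ^+ 2) `^ m - 1 - 2 * m * xi
    - m * (rho ^+ 2 + 2 * (m - 1) * xi ^+ 2)| <=
  2 * m * (2 * m - 1) * (2 * m - 2) / 6 * (rho ^+ 3 * (1 + rho) `^ (2 * m - 3)).
Proof.
move=> m2; rewrite ler_norml => /andP[xi1 xi2].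
set C := _ / 6; set E := (1 + rho) `^ (2 * m - 3).
have C0 : 2 * m * (m - 1) <= C.
  by have : 0 <= m * (m - 1) * (m - 2); [rewrite !mulr_ge0//; lra|rewrite /C; lra].
have rho0 : 0 <= rho by lra.
have E1 : 1 <= E by apply: powR_ge1; lra.
have r0 : 0 <= rho ^+ 3 by apply: exprn_ge0.
have y0 : 0 <= 1 + 2 * xi + rho ^+ 2 by have := sqr_ge0 (1 - rho); lra.
have CE : 2 * m * (m - 1) * rho ^+ 3 <= C * (rho ^+ 3 * E).
  apply: ler_pM => //; [|by rewrite ler_peMr].
  by rewrite mulr_ge0//; lra.
have CE0 : 0 <= C * (rho ^+ 3 * E) by rewrite !mulr_ge0//; nra.
set y := 1 + 2 * xi + rho ^+ 2 in y0 *.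
(* At fixed modulus the remainder is a nondecreasing function of [y], so it is
   extremal at z = rho and z = - rho. *)
pose g y := y `^ m - 1 - m * (y - 1) - m * (m - 1) / 2 * (y - 1 - rho ^+ 2) ^+ 2.
have g_le a b : 0 < a -> a <= b -> g a <= g b.
  move=> a0 ab.
  have /(_ _)/wrap[x /andP[ax xb]|] := @cubic_powR_le R 0 (- (m * (m - 1) / 2))
      (m * (m - 1) * rho ^+ 2 - m) 1 m a b a0 ab; last by rewrite /g; lra.
  have x0 : 0 < x := lt_le_trans a0 ax.
  have : 1 + (m - 1) * (x - 1) <= x `^ (m - 1) by apply: powR_ge_tangent; lra.
  have : 0 <= m * (m - 1) * rho ^+ 2 by rewrite !mulr_ge0 ?sqr_ge0//; lra.
  nra.
have gE : y `^ m - 1 - 2 * m * xi - m * (rho ^+ 2 + 2 * (m - 1) * xi ^+ 2) = g y.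
  rewrite /g (_ : xi = (y - 1 - rho ^+ 2) / 2); first by field.
  by rewrite /y; field.
rewrite gE ler_norml; apply/andP; split.
- have [r1|r1] := ltP rho 1.
    apply: (@le_trans _ _ (g ((1 - rho) ^+ 2))); last first.
      apply: g_le; first by rewrite exprn_gt0//; lra.
      by rewrite /y; lra.
    have r10 : 0 < 1 - rho by lra.
    rewrite /g powR_sqr gtr0_norm//.
    have h : 1 + 2 * m * (1 - rho - 1) + 2 * m * (2 * m - 1) / 2 * (1 - rho - 1) ^+ 2
      + 2 * m * (2 * m - 1) * (2 * m - 2) / 6 * (1 - rho - 1) ^+ 3 <= (1 - rho) `^ (2 * m).
      by apply: powR_third_order_ge_left; lra.
    have : C * rho ^+ 3 <= C * (rho ^+ 3 * E).
      by rewrite ler_wpM2l ?ler_peMr//; nra.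
    rewrite -/C in h; lra.
  have h : 1 + m * (y - 1) <= y `^ m.
    move: y0; rewrite le_eqVlt => /predU1P[<-|y0]; first by rewrite powR0; lra.
    by apply: powR_ge_tangent; lra.
  have x3 : xi ^+ 2 <= rho ^+ 3.
    apply: (@le_trans _ _ (rho ^+ 2)); first by nra.
    by rewrite [leRHS]exprS ler_peMl ?sqr_ge0.
  have : y - 1 - rho ^+ 2 = 2 * xi by rewrite /y; ring.
  have : 0 <= m * (m - 1) * (rho ^+ 3 - xi ^+ 2).
    by rewrite !mulr_ge0 ?subr_ge0//; lra.
  rewrite /g => + ->; lra.
- move: y0; rewrite le_eqVlt => /predU1P[<-|y0].
    rewrite /g powR0; last by lra.
    have : 0 <= m * (m - 1) * (rho ^+ 2 + rho ^+ 2 + rho ^+ 2 * rho ^+ 2).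
      by rewrite mulr_ge0 ?addr_ge0 ?mulr_ge0 ?sqr_ge0//; lra.
    have : 0 <= (m - 1) * (m - 2) by rewrite mulr_ge0//; lra.
    lra.
  apply: (@le_trans _ _ (g ((1 + rho) ^+ 2))); first by apply: g_le => //; rewrite /y; lra.
  rewrite /g powR_sqr ger0_norm; last by lra.
  have h : (1 + rho) `^ (2 * m) <= 1 + 2 * m * (1 + rho - 1)
    + 2 * m * (2 * m - 1) / 2 * (1 + rho - 1) ^+ 2
    + 2 * m * (2 * m - 1) * (2 * m - 2) / 6 * (1 + rho - 1) ^+ 3 * E.
    by apply: powR_third_order_le; lra.
  rewrite -/C in h; lra.
Qed.
End Modulus.

(** * The second order remainder of |1 + z|^p for p at most 4 *)

Section ModulusSmallExponent.
Context {R : realType}.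
Implicit Types (m p rho xi x y : R).

Definition modulus_powR_rem m rho xi := (1 + 2 * xi + rho ^+ 2) `^ m - 1 - 2 * m * xi
    - m * (rho ^+ 2 + 2 * (m - 1) * xi ^+ 2).

Lemma modulus_powR_remE m rho xi y : y = 1 + 2 * xi + rho ^+ 2 ->
  modulus_powR_rem m rho xi = y `^ m - 1 - m * (y - 1) - m * (m - 1) / 2 * (y - 1) ^+ 2 +
    m * (m - 1) / 2 * rho ^+ 2 * (4 * xi + rho ^+ 2).
Proof. by move=> ->; rewrite /modulus_powR_rem; field. Qed.

Lemma modulus_powR_rem_inner m rho xi : 1 <= m <= 2 -> 0 <= rho <= 1 -> - rho <= xi <= rho ->
  2 * xi <= - rho ^+ 2 -> `|modulus_powR_rem m rho xi| <= 2 * m * rho ^+ 3.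
Proof.
move=> m12 /andP[rho0 r1] /andP[xi1 xi2] u0; have /andP[m1 m2] := m12.
set y := 1 + 2 * xi + rho ^+ 2.
have y0 : 0 <= y by rewrite /y; have := sqr_ge0 (1 - rho); lra.
have y1 : y <= 1 by rewrite /y; lra.
have y01 : 0 <= y <= 1 by rewrite y0 y1.
have lo := powR_second_order_ge_left12 m12 y01.
have hi := powR_third_order_le_left12 m12 y01.
have wy : 1 - y <= 2 * rho by rewrite /y; have := sqr_ge0 rho; lra.
rewrite (@modulus_powR_remE _ _ _ y erefl).
move: hi lo; set Y := y `^ m => hi lo.
have w3 : (1 - y) ^+ 3 <= (2 * rho) ^+ 3.
  by rewrite lerXn2r// ?nnegrE ?subr_ge0// mulr_ge0.
have a0 : 0 <= m - 1 by rewrite subr_ge0.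
have b0 : 0 <= 2 - m by rewrite subr_ge0.
have m0 : 0 <= m := le_trans ler01 m1.
have r3 : 0 <= rho ^+ 3 by rewrite exprn_ge0.
have r2 : 0 <= rho ^+ 2 by rewrite exprn_ge0.
have a2 : (m - 1) * (2 - m) <= 1 / 4 by clear; have := sqr_ge0 (m - 3 / 2); lra.
have w0 : 0 <= (1 - y) ^+ 3 by rewrite exprn_ge0// subr_ge0.
have h3 : (m - 1) * (2 - m) * (1 - y) ^+ 3 <= 1 / 4 * (2 * rho) ^+ 3.
  by apply: ler_pM => //; rewrite mulr_ge0.
have h4 : m * (m - 1) * rho ^+ 2 * (4 * xi + rho ^+ 2) <= 0.
  by rewrite mulr_ge0_le0 ?mulr_ge0//; clear -u0 r2; lra.
have h5 : - (m * rho ^+ 3) * 4 <= m * (m - 1) * rho ^+ 2 * (4 * xi + rho ^+ 2).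
  have h : 0 <= 4 * (xi + rho) + rho ^+ 2 by clear -xi1 r2; lra.
  have : 0 <= m * (m - 1) * rho ^+ 2 * (4 * (xi + rho) + rho ^+ 2).
    by rewrite mulr_ge0// mulr_ge0// mulr_ge0.
  have : 0 <= m * (2 - m) * rho ^+ 3 by rewrite !mulr_ge0.
  clear; lra.
have mr3 : rho ^+ 3 <= m * rho ^+ 3 by rewrite ler_peMl.
rewrite ler_norml; clear -lo hi h3 h4 h5 mr3 r3; lra.
Qed.

Lemma modulus_powR_rem_outer m rho xi : 1 <= m <= 2 -> 0 <= rho <= 1 -> - rho <= xi <= rho ->
  - rho ^+ 2 <= 2 * xi ->
  `|modulus_powR_rem m rho xi| <= 2 * m * (rho ^+ 3 * (1 + rho) `^ (m - 1)).
Proof.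
move=> m12 /andP[rho0 r1] /andP[xi1 xi2] u0; have /andP[m1 m2] := m12.
set y := 1 + 2 * xi + rho ^+ 2.
have y1 : 1 <= y by rewrite /y; lra.
have hi := powR_second_order_le_right12 m12 y1.
have lo := powR_third_order_ge_right12 m12 y1.
have rr : rho ^+ 2 <= rho by rewrite expr2 ler_piMl.
have wy : y - 1 <= 3 * rho by rewrite /y; lra.
rewrite (@modulus_powR_remE _ _ _ y erefl).
move: hi lo; set Y := y `^ m => hi lo.
have a0 : 0 <= m - 1 by rewrite subr_ge0.
have b0 : 0 <= 2 - m by rewrite subr_ge0.
have m0 : 0 <= m := le_trans ler01 m1.
have r3 : 0 <= rho ^+ 3 by rewrite exprn_ge0.
have r2 : 0 <= rho ^+ 2 by rewrite exprn_ge0.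
have a2 : (m - 1) * (2 - m) <= 1 / 4 by clear; have := sqr_ge0 (m - 3 / 2); lra.
have w0 : 0 <= (y - 1) ^+ 3 by rewrite exprn_ge0// subr_ge0.
have w3 : (y - 1) ^+ 3 <= (3 * rho) ^+ 3.
  by rewrite lerXn2r// ?nnegrE ?subr_ge0// mulr_ge0.
have h3 : (m - 1) * (2 - m) * (y - 1) ^+ 3 <= 1 / 4 * (3 * rho) ^+ 3.
  by apply: ler_pM => //; rewrite mulr_ge0.
have h3' : m * ((m - 1) * (2 - m) * (y - 1) ^+ 3) <= m * (1 / 4 * (3 * rho) ^+ 3).
  by rewrite ler_wpM2l.
have h4 : - (m * rho ^+ 3) <= m * (m - 1) * rho ^+ 2 * (4 * xi + rho ^+ 2).
  have h : 0 <= 4 * xi + rho ^+ 2 + rho by clear -u0 rr; lra.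
  have : 0 <= m * (m - 1) * rho ^+ 2 * (4 * xi + rho ^+ 2 + rho).
    by rewrite mulr_ge0// mulr_ge0// mulr_ge0.
  have : 0 <= m * (2 - m) * rho ^+ 3 by rewrite !mulr_ge0.
  clear; lra.
(* The explicit term of [modulus_powR_remE] is largest at xi = rho, where it equals m rho^3 (m - 1)
   (4 + rho) / 2; this is what the factor [S] has to absorb. *)
have S2 : (m - 1) * (4 + rho) <= 4 * (1 + rho) `^ (m - 1).
  have : 1 + (m - 1) * (1 + rho - 1) + (m - 1) * (m - 1 - 1) / 2 * (1 + rho - 1) ^+ 2
      <= (1 + rho) `^ (m - 1).
    by apply: powR_second_order_ge_right01; [clear -m1 m2; lra|clear -rho0; lra].
  have : (m - 1) * (2 - m) * rho ^+ 2 <= (m - 1) * rho.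
    by apply: ler_pM => //; [rewrite mulr_ge0|rewrite ler_piMr//; clear -m1; lra].
  have : 0 <= (m - 1) * rho by rewrite mulr_ge0.
  clear -b0; lra.
have S1 : 1 <= (1 + rho) `^ (m - 1) by apply: powR_ge1 => //; rewrite lerDl.
set S := (1 + rho) `^ (m - 1) in S1 S2 *.
have h5 : m * (m - 1) * rho ^+ 2 * (4 * xi + rho ^+ 2) <= m * (rho ^+ 3 * S) * 4.
  have : 0 <= m * (m - 1) * rho ^+ 2 * (rho - xi).
    by rewrite mulr_ge0 ?subr_ge0// mulr_ge0// mulr_ge0.
  have : m * rho ^+ 3 * ((m - 1) * (4 + rho)) <= m * rho ^+ 3 * (4 * S).
    by rewrite ler_wpM2l// mulr_ge0.
  clear; lra.
have mr3 : m * rho ^+ 3 <= m * rho ^+ 3 * S by rewrite ler_peMr// mulr_ge0.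
have mr0 : 0 <= m * rho ^+ 3 by rewrite mulr_ge0.
rewrite ler_norml; clear -lo hi h3' h4 h5 mr3 mr0; lra.
Qed.

Lemma modulus_powR_rem_far_ge m rho xi : 1 <= m <= 2 -> - rho <= xi <= rho ->
  - (2 * m * rho ^+ 2) <= modulus_powR_rem m rho xi.
Proof.
move=> /andP[m1 m2] /andP[xi1 xi2].
set y := 1 + 2 * xi + rho ^+ 2.
have y0 : 0 <= y by rewrite /y; have := sqr_ge0 (1 - rho); lra.
have lin_ge : 1 + m * (y - 1) <= y `^ m.
  move: y0; rewrite le_eqVlt => /predU1P[<-|y0]; first by rewrite powR0; lra.
  by apply: powR_ge_tangent; [|left].
have : 2 * m * (m - 1) * xi ^+ 2 <= 2 * m * rho ^+ 2.
  apply: ler_pM; rewrite ?sqr_ge0//; [|by rewrite ler_piMr; lra|].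
    by rewrite !mulr_ge0//; lra.
  by have : 0 <= (rho - xi) * (rho + xi); [rewrite mulr_ge0|]; lra.
rewrite /modulus_powR_rem -/y; rewrite /y in lin_ge *; lra.
Qed.

Lemma modulus_powR_rem_far_inner m rho xi : 1 <= m <= 2 -> 1 <= rho -> - rho <= xi <= rho ->
  2 * xi <= - rho ^+ 2 -> modulus_powR_rem m rho xi <= 2 * m * rho ^+ 2.
Proof.
move=> m12 r1 /andP[xi1 xi2] u0; have /andP[m1 m2] := m12.
set y := 1 + 2 * xi + rho ^+ 2.
have y0 : 0 <= y by rewrite /y; have := sqr_ge0 (1 - rho); lra.
have y1 : y <= 1 by rewrite /y; lra.
have y01 : 0 <= y <= 1 by rewrite y0 y1.
have hi := powR_third_order_le_left12 m12 y01.
rewrite (@modulus_powR_remE _ _ _ y erefl).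
move: hi; set Y := y `^ m => hi.
have w3 : (1 - y) ^+ 3 <= 1 by rewrite exprn_ile1//; lra.
have w0 : 0 <= (1 - y) ^+ 3 by rewrite exprn_ge0// subr_ge0.
have a0 : 0 <= m - 1 by rewrite subr_ge0.
have b0 : 0 <= 2 - m by rewrite subr_ge0.
have m0 : 0 <= m := le_trans ler01 m1.
have r2 : 1 <= rho ^+ 2 by rewrite exprn_ege1.
have a2 : (m - 1) * (2 - m) <= 1 / 4 by clear; have := sqr_ge0 (m - 3 / 2); lra.
have h3 : (m - 1) * (2 - m) * (1 - y) ^+ 3 <= 1 / 4 * 1.
  by apply: ler_pM => //; rewrite mulr_ge0.
have h4 : m * (m - 1) * rho ^+ 2 * (4 * xi + rho ^+ 2) <= 0.
  rewrite mulr_ge0_le0//; last by clear -u0 r2; lra.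
  by rewrite mulr_ge0 ?sqr_ge0// mulr_ge0.
have : 1 * 1 <= m * rho ^+ 2 by rewrite ler_pM.
clear -hi h3 h4; lra.
Qed.

Lemma modulus_powR_rem_mid m rho xi : 1 <= m <= 2 -> 1 <= rho <= 2 -> - rho <= xi <= rho ->
  - rho ^+ 2 <= 2 * xi ->
  modulus_powR_rem m rho xi <= 2 * m * (rho `^ (m + 1) * (1 + rho) `^ (m - 1)).
Proof.
move=> m12 /andP[r1 r2'] /andP[xi1 xi2] u0; have /andP[m1 m2] := m12.
have rho0 : 0 < rho by lra.
set y := 1 + 2 * xi + rho ^+ 2.
have y1 : 1 <= y by rewrite /y; lra.
have hi := powR_second_order_le_right12 m12 y1.
rewrite (@modulus_powR_remE _ _ _ y erefl).
move: hi; set Y := y `^ m => hi.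
have a0 : 0 <= m - 1 by rewrite subr_ge0.
have b0 : 0 <= 2 - m by rewrite subr_ge0.
have m0 : 0 <= m := le_trans ler01 m1.
have X0 : 0 <= rho `^ (m + 1) by exact: powR_ge0.
have X3 : rho ^+ 3 <= rho `^ (m + 1) * (1 + (2 - m) * (rho - 1)).
  have -> : rho ^+ 3 = rho `^ (m + 1) * rho `^ (2 - m).
    rewrite -powRD; last by rewrite (gt_eqF rho0) implybT.
    by rewrite -(powR_mulrn 3 (ltW rho0)); congr (_ `^ _); ring.
  by rewrite ler_wpM2l// powR_le_tangent//; lra.
set X := rho `^ (m + 1) in X0 X3 *.
have S2 : (m - 1) * (4 + rho) * (1 + (2 - m) * (rho - 1)) <= 4 * (1 + rho) `^ (m - 1).
  have : 1 + (m - 1) * (1 + rho - 1) + (m - 1) * (m - 1 - 1) / 2 * (1 + rho - 1) ^+ 2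
      <= (1 + rho) `^ (m - 1) by apply: powR_second_order_ge_right01; lra.
  (* With the power replaced by its quadratic lower bound, the gap is a concave quadratic in rho. It
     is therefore nonnegative on [1, 2] once it is so at both ends; the next two facts are its end
     values with their interpolation weights. *)
  have : 0 <= (m - 1) * (2 - m) * ((2 - rho) * (rho - 1)).
    by rewrite mulr_ge0// mulr_ge0//; lra.
  have : 0 <= (2 - rho) * (4 - 3 * (m - 1) + 2 * (m - 1) ^+ 2).
    by rewrite mulr_ge0//; clear -m1 m2 r2'; nra.
  have : 0 <= (rho - 1) * (4 - 12 * (m - 1) + 14 * (m - 1) ^+ 2).
    rewrite mulr_ge0//; first by rewrite subr_ge0.
    by clear; have := sqr_ge0 (7 * (m - 1) - 3); lra.
  clear; lra.
set S := (1 + rho) `^ (m - 1) in S2 *.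
have h5 : m * (m - 1) * rho ^+ 2 * (4 * xi + rho ^+ 2) <=
    m * (m - 1) * (4 + rho) * rho ^+ 3.
  have : 0 <= m * (m - 1) * rho ^+ 2 * (rho - xi).
    by rewrite mulr_ge0 ?subr_ge0// mulr_ge0 ?sqr_ge0// mulr_ge0.
  clear; lra.
have r40 : 0 <= 4 + rho by lra.
have h6 : m * (m - 1) * (4 + rho) * rho ^+ 3 <=
    m * (m - 1) * (4 + rho) * (X * (1 + (2 - m) * (rho - 1))).
  by rewrite ler_wpM2l// !mulr_ge0.
have h7 : m * X * ((m - 1) * (4 + rho) * (1 + (2 - m) * (rho - 1))) <= m * X * (4 * S).
  by rewrite ler_wpM2l// mulr_ge0.
clear -hi h5 h6 h7; lra.
Qed.

(** [powRD1_le] cancels the affine part and leaves (y - 1)^m <= rho^m (2 + rho)^m. The constant 2 m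
    is exact bookkeeping: 2 + rho <= 2 rho gives the 2, and 2^(m-1) <= m gives the m. *)
Lemma modulus_powR_rem_far m rho xi : 1 <= m <= 2 -> 2 <= rho -> - rho <= xi <= rho ->
  1 < 1 + 2 * xi + rho ^+ 2 ->
  modulus_powR_rem m rho xi <= 2 * m * (rho `^ (m + 1) * (1 + rho) `^ (m - 1)).
Proof.
move=> m12 r2 /andP[xi1 xi2]; have /andP[m1 m2] := m12.
have rho0 : 0 < rho by lra.
set y := 1 + 2 * xi + rho ^+ 2 => y1.
have a0 : 0 <= m - 1 by rewrite subr_ge0.
have m0 : 0 <= m := le_trans ler01 m1.
have hi : y `^ m <= 1 + m * (y - 1) + (y - 1) `^ m.
  by rewrite [X in X `^ _ <= _](_ : y = 1 + (y - 1)); [apply: powRD1_le; lra|ring].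
have um : (y - 1) `^ m <= rho `^ m * (2 + rho) `^ m.
  rewrite -powRM; [|lra|lra].
  have yr : y - 1 <= rho * (2 + rho) by rewrite /y; lra.
  by rewrite ge0_ler_powR ?nnegrE//; clear -yr y1; lra.
have r2S : (2 + rho) `^ (m - 1) <= m * (1 + rho) `^ (m - 1).
  apply: (@le_trans _ _ ((2 * (1 + rho)) `^ (m - 1))).
    by rewrite ge0_ler_powR ?nnegrE; lra.
  rewrite powRM; [|lra|lra].
  rewrite ler_wpM2r ?powR_ge0//.
  have : 2 `^ (m - 1) <= 1 + (m - 1) * (2 - 1) :> R by apply: powR_le_tangent; lra.
  by rewrite (_ : 1 + _ = m)//; ring.
have rm : rho `^ m * rho = rho `^ (m + 1).
  rewrite -[X in _ * X = _](powRr1 (ltW rho0)) -powRD//.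
  by rewrite (gt_eqF rho0) implybT.
have um2 : (2 + rho) `^ m <= 2 * rho * (m * (1 + rho) `^ (m - 1)).
  rewrite -(@mulr_powRB1 _ (2 + rho) m); [|lra|lra].
  by apply: ler_pM => //; rewrite ?powR_ge0//; lra.
have um3 : rho `^ m * (2 + rho) `^ m <= rho `^ m * (2 * rho * (m * (1 + rho) `^ (m - 1))).
  by rewrite ler_wpM2l// powR_ge0.
have : 0 <= 2 * m * (m - 1) * xi ^+ 2 by rewrite mulr_ge0 ?sqr_ge0// !mulr_ge0.
rewrite /modulus_powR_rem -/y -rm; move: hi um um3; rewrite /y; clear.
set A := powR _ _; set B := powR _ _; set C := powR _ _; set D := powR _ _.
set E := powR _ _.
lra.
Qed.

Lemma modulus_powR_second_order_le4 m rho xi : 1 <= m <= 2 -> `|xi| <= rho ->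
  `|(1 + 2 * xi + rho ^+ 2) `^ m - 1 - 2 * m * xi
    - m * (rho ^+ 2 + 2 * (m - 1) * xi ^+ 2)| <=
  2 * m * (rho `^ (m + 1) * (1 + rho) `^ (m - 1)).
Proof.
move=> m12 hxi; have /andP[m1 m2] := m12; rewrite -/(modulus_powR_rem m rho xi).
have [rho0|rho0] := eqVneq rho 0.
  move: hxi; rewrite rho0 normr_le0 => /eqP ->.
  rewrite /modulus_powR_rem expr0n /= !mulr0 !addr0 powR1 mulr0 subrr !subr0 normr0.
  by rewrite !mulr_ge0 ?powR_ge0//; lra.
have {}rho0 : 0 < rho by rewrite lt_def rho0 (le_trans _ hxi).
have {}hxi : - rho <= xi <= rho by rewrite -ler_norml.
have S1 : 1 <= (1 + rho) `^ (m - 1) by apply: powR_ge1; lra.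
have X0 : 0 <= rho `^ (m + 1) by apply: powR_ge0.
have m0 : 0 <= 2 * m by lra.
have [r1|/ltW r1] := leP rho 1.
  have r01 : 0 <= rho <= 1 by rewrite ltW.
  have Xr : rho ^+ 3 <= rho `^ (m + 1).
    by rewrite -(powR_mulrn 3 (ltW rho0)) ger_powR ?rho0//; lra.
  have [u0|/ltW u0] := leP (2 * xi) (- rho ^+ 2).
    apply: (le_trans (modulus_powR_rem_inner m12 r01 hxi u0)).
    by rewrite ler_wpM2l// (le_trans Xr)// ler_peMr.
  apply: (le_trans (modulus_powR_rem_outer m12 r01 hxi u0)).
  by rewrite ler_wpM2l// ler_wpM2r// (le_trans ler01).
have Xr : 2 * m * rho ^+ 2 <= 2 * m * (rho `^ (m + 1) * (1 + rho) `^ (m - 1)).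
  rewrite ler_wpM2l//; apply: (@le_trans _ _ (rho `^ (m + 1))); last by rewrite ler_peMr.
  by rewrite -(powR_mulrn 2 (ltW rho0)) ler_powR//; lra.
rewrite ler_norml; apply/andP; split.
  by apply: le_trans (modulus_powR_rem_far_ge m12 hxi); rewrite lerN2.
have [u0|u0] := leP (2 * xi) (- rho ^+ 2).
  exact: le_trans (modulus_powR_rem_far_inner m12 r1 hxi u0) Xr.
have [r2|/ltW r2] := leP rho 2.
  by apply: modulus_powR_rem_mid => //; [rewrite r1|exact: ltW].
by apply: modulus_powR_rem_far => //; lra.
Qed.
End ModulusSmallExponent.

(** * Expansion of |f + x + iy|^p *)

Section Homogeneous.
Context {R : realType}.
Implicit Types (a e f g h k m p q r s t u v x y : R).

Lemma powRD_ge0 r u v : 0 <= r -> 0 < u -> 0 < v ->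
  r `^ u * r `^ v = r `^ (u + v).
Proof.
rewrite le_eqVlt => /predU1P[<-|r0] u0 v0.
  by rewrite !powR0 ?mul0r//; lra.
by rewrite -powRD// (gt_eqF r0) implybT.
Qed.

(* For f != 0, z = (x + i y) / f reduces the estimates on |f + x + i y| to
   those on |1 + z|. *)
Lemma modulus_rescale m f x y (r := Num.sqrt (x ^+ 2 + y ^+ 2)) : f != 0 ->
  [/\ `|x / f| <= r / `|f|,
      ((f + x) ^+ 2 + y ^+ 2) `^ m =
        `|f| `^ (2 * m) * (1 + 2 * (x / f) + (r / `|f|) ^+ 2) `^ m,
      f * `|f| `^ (2 * m - 2) * x = `|f| `^ (2 * m) * (x / f),
      `|f| `^ (2 * m - 2) * x ^+ 2 = `|f| `^ (2 * m) * (x / f) ^+ 2 &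
      `|f| `^ (2 * m - 2) * r ^+ 2 = `|f| `^ (2 * m) * (r / `|f|) ^+ 2].
Proof.
move=> f0; have nf : 0 < `|f| by rewrite normr_gt0.
have nf0 : `|f| != 0 by rewrite gt_eqF.
have fE : `|f| `^ (2 * m) = f ^+ 2 * `|f| `^ (2 * m - 2).
  rewrite -[f ^+ 2]real_normK ?num_real// -(powR_mulrn 2 (ltW nf)) -powRD.
    by congr (_ `^ _); ring.
  by rewrite nf0 implybT.
have r2 : r ^+ 2 = x ^+ 2 + y ^+ 2 by rewrite sqr_sqrtr// addr_ge0 ?sqr_ge0.
have nf2 : `|f| ^+ 2 = f ^+ 2 by rewrite real_normK ?num_real.
split.
- rewrite normrM normfV ler_wpM2r ?invr_ge0// /r -(sqrtr_sqr x) ler_wsqrtr//.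
  by rewrite lerDl sqr_ge0.
- rewrite -powR_sqr -powRM ?sqr_ge0//; first congr (_ `^ _).
    by rewrite expr_div_n r2 nf2; field.
  rewrite expr_div_n r2 nf2.
  have -> : 1 + 2 * (x / f) + (x ^+ 2 + y ^+ 2) / f ^+ 2 =
    (1 + x / f) ^+ 2 + (y / f) ^+ 2 by field.
  by rewrite addr_ge0 ?sqr_ge0.
- by rewrite fE; field.
- by rewrite fE; field.
- by rewrite fE expr_div_n nf2; field.
Qed.

Lemma powR_rescale q f r : f != 0 -> 0 <= r ->
  (`|f| + r) `^ q = `|f| `^ q * (1 + r / `|f|) `^ q.
Proof.
move=> f0 r0; have nf : 0 < `|f| by rewrite normr_gt0.
rewrite -powRM ?normr_ge0 ?addr_ge0 ?divr_ge0//; congr (_ `^ _).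
by field; rewrite gt_eqF.
Qed.

Lemma first_order_le m f x y (r := Num.sqrt (x ^+ 2 + y ^+ 2)) : 1 < m ->
  ((f + x) ^+ 2 + y ^+ 2) `^ m - `|f| `^ (2 * m)
    - 2 * m * (f * `|f| `^ (2 * m - 2) * x) <=
  m * (2 * m - 1) * (r ^+ 2 * (`|f| + r) `^ (2 * m - 2)).
Proof.
move=> m1; have r0 : 0 <= r by exact: sqrtr_ge0.
have [->|f0] := eqVneq f 0.
  rewrite normr0 !add0r powR0; last by lra.
  rewrite -[X in X `^ m](@sqr_sqrtr _ (x ^+ 2 + y ^+ 2)) ?addr_ge0 ?sqr_ge0//.
  rewrite powR_sqr -/r ger0_norm// -(powR_mulrn 2 r0) powRD_ge0//; [|lra].
  rewrite !mul0r mulr0 !subr0 (_ : 2 + _ = 2 * m); last by ring.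
  by rewrite ler_peMl ?powR_ge0//; nra.
have [z1 -> -> _ rE] := modulus_rescale m x y f0; rewrite -/r in z1 rE *.
rewrite powR_rescale//.
have h := ler_wpM2l (powR_ge0 `|f| (2 * m)) (modulus_powR_first_order (ltW m1) z1).
rewrite [r ^+ 2 * _]mulrA [r ^+ 2 * _]mulrC rE.
by move: h; congr (_ <= _); ring.
Qed.

Lemma second_order_le_ge4 m f x y (r := Num.sqrt (x ^+ 2 + y ^+ 2)) : 2 <= m ->
  `|((f + x) ^+ 2 + y ^+ 2) `^ m - `|f| `^ (2 * m)
    - 2 * m * (f * `|f| `^ (2 * m - 2) * x)
    - m * ((2 * m - 1) * (`|f| `^ (2 * m - 2) * x ^+ 2) + `|f| `^ (2 * m - 2) * y ^+ 2)| <=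
  2 * m * (2 * m - 1) * (2 * m - 2) / 6 * (r `^ 3 * (`|f| + r) `^ (2 * m - 3)).
Proof.
move=> m2; have r0 : 0 <= r by exact: sqrtr_ge0.
have r2 : r ^+ 2 = x ^+ 2 + y ^+ 2 by rewrite sqr_sqrtr// addr_ge0 ?sqr_ge0.
have [->|f0] := eqVneq f 0.
  rewrite normr0 !add0r !powR0; [|lra|lra].
  rewrite -r2 powR_sqr (ger0_norm r0) powRD_ge0//; [|lra].
  rewrite !mul0r addr0 !mulr0 !subr0 (_ : 3 + _ = 2 * m); last by ring.
  rewrite ger0_norm ?powR_ge0// ler_peMl ?powR_ge0//.
  have : 0 <= (m - 2) * (m * (m - 1)) by rewrite mulr_ge0//; nra.
  nra.
have -> : (2 * m - 1) * (`|f| `^ (2 * m - 2) * x ^+ 2) + `|f| `^ (2 * m - 2) * y ^+ 2 =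
  `|f| `^ (2 * m - 2) * r ^+ 2 + 2 * (m - 1) * (`|f| `^ (2 * m - 2) * x ^+ 2).
  by rewrite r2; ring.
have [z1 -> -> -> rE] := modulus_rescale m x y f0; rewrite -/r in z1 rE *.
rewrite rE powR_rescale//.
have h := ler_wpM2l (powR_ge0 `|f| (2 * m)) (modulus_powR_second_order_ge4 m2 z1).
have -> : r `^ 3 * (`|f| `^ (2 * m - 3) * (1 + r / `|f|) `^ (2 * m - 3)) =
    `|f| `^ (2 * m) * ((r / `|f|) ^+ 3 * (1 + r / `|f|) `^ (2 * m - 3)).
  have -> : `|f| `^ (2 * m) = `|f| ^+ 3 * `|f| `^ (2 * m - 3).
    rewrite -(powR_mulrn 3 (normr_ge0 f)) -powRD; first by congr (_ `^ _); ring.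
    by rewrite normr_eq0 f0 implybT.
  by rewrite (powR_mulrn 3 r0); field; rewrite normr_eq0.
rewrite [leRHS]mulrCA; apply: le_trans h.
rewrite -[X in X * `|_|](ger0_norm (powR_ge0 `|f| (2 * m))) -normrM.
rewrite le_eqVlt; apply/orP; left; apply/eqP; congr `|_|; ring.
Qed.

Lemma second_order_le_le4 m f x y (r := Num.sqrt (x ^+ 2 + y ^+ 2)) : 1 < m <= 2 ->
  `|((f + x) ^+ 2 + y ^+ 2) `^ m - `|f| `^ (2 * m)
    - 2 * m * (f * `|f| `^ (2 * m - 2) * x)
    - m * ((2 * m - 1) * (`|f| `^ (2 * m - 2) * x ^+ 2) + `|f| `^ (2 * m - 2) * y ^+ 2)| <=
  2 * m * (r `^ (m + 1) * (`|f| + r) `^ (m - 1)).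
Proof.
move=> /andP[m1 m2]; have r0 : 0 <= r by exact: sqrtr_ge0.
have m12 : 1 <= m <= 2 by rewrite ltW.
have r2 : r ^+ 2 = x ^+ 2 + y ^+ 2 by rewrite sqr_sqrtr// addr_ge0 ?sqr_ge0.
have [->|f0] := eqVneq f 0.
  rewrite normr0 !add0r !powR0; [|lra|lra].
  rewrite -r2 powR_sqr (ger0_norm r0) powRD_ge0//; [|lra|lra].
  rewrite !mul0r addr0 !mulr0 !subr0 (_ : m + 1 + _ = 2 * m); last by ring.
  by rewrite ger0_norm ?powR_ge0// ler_peMl ?powR_ge0//; lra.
have -> : (2 * m - 1) * (`|f| `^ (2 * m - 2) * x ^+ 2) + `|f| `^ (2 * m - 2) * y ^+ 2 =
  `|f| `^ (2 * m - 2) * r ^+ 2 + 2 * (m - 1) * (`|f| `^ (2 * m - 2) * x ^+ 2).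
  by rewrite r2; ring.
have [z1 -> -> -> rE] := modulus_rescale m x y f0; rewrite -/r in z1 rE *.
rewrite rE powR_rescale//.
have h := ler_wpM2l (powR_ge0 `|f| (2 * m)) (modulus_powR_second_order_le4 m12 z1).
have -> : r `^ (m + 1) * (`|f| `^ (m - 1) * (1 + r / `|f|) `^ (m - 1)) =
    `|f| `^ (2 * m) * ((r / `|f|) `^ (m + 1) * (1 + r / `|f|) `^ (m - 1)).
  have -> : `|f| `^ (2 * m) = `|f| `^ (m + 1) * `|f| `^ (m - 1).
    rewrite -powRD; first by congr (_ `^ _); ring.
    by rewrite normr_eq0 f0 implybT.
  have {1}-> : r = `|f| * (r / `|f|) by field; rewrite normr_eq0.
  by rewrite powRM ?divr_ge0//; ring.
rewrite [leRHS]mulrCA; apply: le_trans h.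
rewrite -[X in X * `|_|](ger0_norm (powR_ge0 `|f| (2 * m))) -normrM.
rewrite le_eqVlt; apply/orP; left; apply/eqP; congr `|_|; ring.
Qed.

(** Jensen's inequality for the weights 1 and e, by summing the tangents at the weighted mean t. *)
Lemma powR_mean_le p e u v : 1 <= p -> 0 <= e -> 0 <= u -> 0 <= v ->
  (u + e * v) `^ p <= (1 + e) `^ (p - 1) * (u `^ p + e * v `^ p).
Proof.
move=> p1 e0 u0 v0; have e1 : 0 < 1 + e by lra.
set t := (u + e * v) / (1 + e).
have t0 : 0 <= t by rewrite divr_ge0 ?addr_ge0 ?mulr_ge0// ltW.
have h1 := powR_tangent p1 t0 u0.
have h2 := ler_wpM2l e0 (powR_tangent p1 t0 v0).
have tE : u + e * v = (1 + e) * t by rewrite /t; field; lra.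
rewrite tE (powRM _ (ltW e1) t0) -(@mulr_powRB1 _ (1 + e) p (ltW e1)); last by lra.
rewrite [leLHS](_ : _ = (1 + e) `^ (p - 1) * ((1 + e) * t `^ p)); last by ring.
rewrite ler_wpM2l ?powR_ge0//.
have : (1 + e) * t `^ p = (t `^ p + p * t `^ (p - 1) * (u - t)) +
  e * (t `^ p + p * t `^ (p - 1) * (v - t)).
  by rewrite (_ : u = (1 + e) * t - e * v); [ring|lra].
lra.
Qed.

Lemma young_powR p a s t : 0 < a < p -> 0 <= s -> 0 <= t ->
  s `^ a * t `^ (p - a) <= a / p * s `^ p + (p - a) / p * t `^ p.
Proof.
move=> /andP[a0 ap] s0 t0.
have p0 : 0 < p := lt_trans a0 ap.
have pa0 : 0 < p - a by rewrite subr_gt0.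
have := @conjugate_powR _ (s `^ a) (t `^ (p - a)) (p / a) (p / (p - a))
  (powR_ge0 _ _) (powR_ge0 _ _) (divr_gt0 p0 a0) (divr_gt0 p0 pa0).
have -> : (p / a)^-1 + (p / (p - a))^-1 = 1 by field; rewrite !gt_eqF.
rewrite -!powRrM.
have -> : a * (p / a) = p by field; rewrite gt_eqF.
have -> : (p - a) * (p / (p - a)) = p by field; rewrite gt_eqF.
move=> /(_ erefl); congr (_ <= _); field.
by rewrite !gt_eqF.
Qed.

(** Young's inequality is applied to v and the mean t = (u + e v) / (1 + e) after the powers of e
    and 1 + e are pulled out; Jensen then replaces t^p by a mean of u^p and v^p. The bracket has
    total weight 1. *)
Lemma young_mean p a e u v : 1 <= p -> 0 < a < p -> 0 <= e -> 0 <= u -> 0 <= v ->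
  (e * v) `^ a * (u + e * v) `^ (p - a) <=
  e `^ a * (1 + e) `^ (p - a) *
    (a / p * v `^ p + (p - a) / p * ((1 + e)^-1 * (u `^ p + e * v `^ p))).
Proof.
move=> p1 ap e0 u0 v0; have /andP[a0 ap'] := ap.
have e1 : 0 < 1 + e by lra.
set t := (u + e * v) / (1 + e).
have t0 : 0 <= t by rewrite divr_ge0 ?addr_ge0 ?mulr_ge0// ltW.
have tE : u + e * v = (1 + e) * t by rewrite /t; field; lra.
rewrite (powRM _ e0 v0) {1}tE (powRM _ (ltW e1) t0).
rewrite [leLHS](_ : _ = e `^ a * (1 + e) `^ (p - a) * (v `^ a * t `^ (p - a))); last by ring.
rewrite ler_wpM2l ?mulr_ge0 ?powR_ge0//.
apply: (le_trans (young_powR ap v0 t0)); rewrite lerD2l ler_wpM2l//.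
  by rewrite divr_ge0//; lra.
rewrite -(ler_pM2l (powR_gt0 p e1)) -(powRM _ (ltW e1) t0) -tE.
apply: (le_trans (powR_mean_le p1 e0 u0 v0)).
rewrite -(@mulr_powRB1 _ (1 + e) p (ltW e1)); last by lra.
rewrite le_eqVlt; apply/orP; left; apply/eqP; field; lra.
Qed.
End Homogeneous.

Section PointwiseBounds.
Context {R : realType}.
Implicit Types (e f m x y : R).

Lemma powR_sub2_mul_sqr m f : 1 < m ->
  `|f| `^ (2 * m - 2) * f ^+ 2 = `|f| `^ (2 * m).
Proof.
move=> m1; rewrite -[f ^+ 2]real_normK ?num_real// -(powR_mulrn 2 (normr_ge0 _)).
by rewrite powRD_ge0//; [congr (_ `^ _); ring|lra].
Qed.

(** Integrated against unit norms, the weights add up to 1. This is the source of L <= p - 1. *)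
Lemma second_order_terms_le m f x y : 1 < m ->
  `|f| `^ (2 * m - 2) * x ^+ 2 + `|f| `^ (2 * m - 2) * y ^+ 2 <=
  (2 * m - 2) / (2 * m) * `|f| `^ (2 * m)
    + 2 / (2 * m) * Num.sqrt (x ^+ 2 + y ^+ 2) `^ (2 * m).
Proof.
move=> m1; have r0 : 0 <= Num.sqrt (x ^+ 2 + y ^+ 2) by exact: sqrtr_ge0.
have r2 : Num.sqrt (x ^+ 2 + y ^+ 2) ^+ 2 = x ^+ 2 + y ^+ 2.
  by rewrite sqr_sqrtr// addr_ge0 ?sqr_ge0.
rewrite -mulrDr; set r := Num.sqrt _ in r0 r2 *; rewrite -r2.
have a2 : (0 : R) < 2 < 2 * m by apply/andP; split; lra.
have := young_powR a2 r0 (normr_ge0 f).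
by rewrite (powR_mulrn 2 r0) [r ^+ 2 * _]mulrC [X in _ <= X -> _]addrC.
Qed.

Lemma modulus_powR_le m e f x y : 1 < m ->
  ((f + e * x) ^+ 2 + (e * y) ^+ 2) `^ m <=
  (1 + `|e|) `^ (2 * m - 1) *
    (`|f| `^ (2 * m) + `|e| * Num.sqrt (x ^+ 2 + y ^+ 2) `^ (2 * m)).
Proof.
move=> m1; have r0 : 0 <= Num.sqrt (x ^+ 2 + y ^+ 2) by exact: sqrtr_ge0.
have r2 : Num.sqrt (x ^+ 2 + y ^+ 2) ^+ 2 = x ^+ 2 + y ^+ 2.
  by rewrite sqr_sqrtr// addr_ge0 ?sqr_ge0.
have xr : `|x| <= Num.sqrt (x ^+ 2 + y ^+ 2).
  by rewrite -(sqrtr_sqr x) ler_wsqrtr// lerDl sqr_ge0.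
set r := Num.sqrt _ in r0 r2 xr *.
have e0 := normr_ge0 e; have f0 := normr_ge0 f.
apply: le_trans (powR_mean_le _ e0 f0 r0); last by lra.
have hs : 0 <= `|f| + `|e| * r by rewrite addr_ge0// mulr_ge0.
rewrite -[X in _ <= X `^ _](ger0_norm hs) -powR_sqr.
rewrite ge0_ler_powR ?nnegrE ?addr_ge0 ?sqr_ge0//; first by lra.
have fx : f * x * e <= `|f| * r * `|e|.
  apply: (le_trans (ler_norm _)); rewrite !normrM.
  by rewrite ler_wpM2r// ler_wpM2l.
rewrite (_ : (`|f| + `|e| * r) ^+ 2 =
  `|f| ^+ 2 + 2 * (`|f| * r * `|e|) + `|e| ^+ 2 * r ^+ 2); last by ring.
rewrite !real_normK ?num_real// r2; lra.
Qed.

Lemma first_order_term_le m f x : 1 < m ->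
  `|f * `|f| `^ (2 * m - 2) * x| <= `|f| `^ (2 * m) + `|f| `^ (2 * m - 2) * x ^+ 2.
Proof.
move=> m1; rewrite -powR_sub2_mul_sqr// -mulrDr [f * _]mulrC -mulrA normrM.
rewrite ger0_norm ?powR_ge0// ler_wpM2l ?powR_ge0// ler_norml.
by have := sqr_ge0 (f - x); have := sqr_ge0 (f + x); have := sqr_ge0 f;
  have := sqr_ge0 x; lra.
Qed.

(** Cauchy-Schwarz before integration: the expression is |f|^(p-2) (x - a f)^2, and [a] will be the
    integral of the middle factor. *)
Lemma first_order_term_quadratic m f x a : 1 < m ->
  0 <= `|f| `^ (2 * m - 2) * x ^+ 2 - 2 * a * (f * `|f| `^ (2 * m - 2) * x)
    + a ^+ 2 * `|f| `^ (2 * m).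
Proof.
move=> m1; rewrite -powR_sub2_mul_sqr//.
rewrite [leRHS](_ : _ = `|f| `^ (2 * m - 2) * (x - a * f) ^+ 2); last by ring.
by rewrite mulr_ge0 ?powR_ge0 ?sqr_ge0.
Qed.

(** Hoelder before integration: Young's inequality between |f|^(p-1) and |f + e psi| / t. With t = 1
    + e a the left side integrates to 1, and the right side to (p-1)/p + Q / (p t^p), so Q >=
    t^p. *)
Lemma duality_young m e t f x y : 1 < m -> 0 < t ->
  (`|f| `^ (2 * m) + e * (f * `|f| `^ (2 * m - 2) * x)) / t <=
  (2 * m - 1) / (2 * m) * `|f| `^ (2 * m) +
  1 / (2 * m) * (((f + e * x) ^+ 2 + (e * y) ^+ 2) `^ m / t `^ (2 * m)).
Proof.
move=> m1 t0; set h := (f + e * x) ^+ 2 + _.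
have h0 : 0 <= h by rewrite addr_ge0 ?sqr_ge0.
have r0 : 0 <= Num.sqrt h by exact: sqrtr_ge0.
have hE : h `^ m = Num.sqrt h `^ (2 * m).
  by rewrite -[in LHS](sqr_sqrtr h0) powR_sqr ger0_norm.
have fh : `|f + e * x| <= Num.sqrt h.
  by rewrite -sqrtr_sqr ler_wsqrtr// lerDl sqr_ge0.
have tr0 : 0 <= Num.sqrt h / t by rewrite divr_ge0// ltW.
have a1 : (0 : R) < 1 < 2 * m by apply/andP; split; lra.
have tV : t^-1 `^ (2 * m) = (t `^ (2 * m))^-1.
  by rewrite -(powR_inv1 (ltW t0)) -powRrM mulN1r powRN.
have := young_powR a1 tr0 (normr_ge0 f).
rewrite (powRr1 tr0) (powRM _ r0) ?tV; last by rewrite invr_ge0 ltW.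
rewrite -hE [X in _ <= X -> _]addrC; apply: le_trans.
rewrite [leRHS]mulrAC ler_wpM2r//; first by rewrite invr_ge0 ltW.
rewrite -powR_sub2_mul_sqr// -(@mulr_powRB1 _ `|f| (2 * m - 1)) ?normr_ge0//; last by lra.
rewrite (_ : 2 * m - 1 - 1 = 2 * m - 2); last by ring.
rewrite [leLHS](_ : _ = `|f| `^ (2 * m - 2) * (f * (f + e * x))); last by ring.
rewrite [leRHS](_ : _ = `|f| `^ (2 * m - 2) * (`|f| * Num.sqrt h)); last by ring.
rewrite ler_wpM2l ?powR_ge0//; apply: (le_trans (ler_norm _)).
by rewrite normrM ler_wpM2l.
Qed.
End PointwiseBounds.

(** * Integration *)

Section IntegralComb.
Context d (T : measurableType d) (R : realType).
Variable mu : {measure set T -> \bar R}.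

(** Listing coefficients with functions lets a pointwise inequality between any number of terms be
    integrated in one step. On a concrete list the hypothesis computes to a conjunction of
    integrability facts. *)
Lemma Rintegral_comb (s : seq (R * (T -> R))) :
  foldr (fun cg P => mu.-integrable setT (EFin \o cg.2) /\ P) True s ->
  mu.-integrable setT (EFin \o (fun x => \sum_(cg <- s) cg.1 * cg.2 x)) /\
  \int[mu]_x (\sum_(cg <- s) cg.1 * cg.2 x) = \sum_(cg <- s) cg.1 * \int[mu]_x cg.2 x.
Proof.
elim: s => [_|[c g] s IH /= [ig /IH[is_ sE]]].
  split; first by under eq_fun do rewrite big_nil; exact: integrable0.
  by under eq_Rintegral do rewrite big_nil; rewrite big_nil Rintegral_cst// mul0r.
have icg : mu.-integrable setT (EFin \o (fun x => c * g x)).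
  rewrite (_ : EFin \o _ = (fun x => c%:E * (EFin \o g) x)%E); first exact: integrableZl.
  by apply/funext => x /=; rewrite EFinM.
split.
  rewrite (_ : EFin \o _ = ((EFin \o (fun x => c * g x)%R) \+
    (EFin \o (fun x => \sum_(cg <- s) cg.1 * cg.2 x)%R))%E); first exact: integrableD.
  by apply/funext => x /=; rewrite big_cons/= EFinD.
under eq_Rintegral do rewrite big_cons/=.
by rewrite big_cons/= RintegralD// RintegralZl// sE.
Qed.

Lemma Rintegral_comb_ge0 (s : seq (R * (T -> R))) :
  foldr (fun cg P => mu.-integrable setT (EFin \o cg.2) /\ P) True s ->
  (forall x, 0 <= \sum_(cg <- s) cg.1 * cg.2 x) ->
  0 <= \sum_(cg <- s) cg.1 * \int[mu]_x cg.2 x.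
Proof. by move=> /Rintegral_comb[_ <-] s0; apply: Rintegral_ge0 => x _; exact: s0. Qed.

Lemma integrable_dominated (g h : T -> R) : measurable_fun setT g ->
  mu.-integrable setT (EFin \o h) -> (forall x, `|g x| <= h x) ->
  mu.-integrable setT (EFin \o g).
Proof.
move=> mg ih gh; apply: (le_integrable measurableT _ _ ih).
  exact/measurable_EFinP.
by move=> x _ /=; rewrite lee_fin (le_trans (gh x)) ?ler_norm.
Qed.

Lemma measurable_powRT (g : T -> R) (q : R) : measurable_fun setT g ->
  measurable_fun setT (fun x => g x `^ q).
Proof. exact: (@measurableT_comp _ _ _ _ _ _ (@powR R ^~ q)). Qed.

End IntegralComb.

(** * Coefficients, norm bounds and expansion of the integral of |f + e psi|^p *)

Section IntegralExpansion.
Context d (T : measurableType d) (R : realType).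
Variables (mu : {measure set T -> \bar R}) (m : R) (f xi eta : T -> R).
Hypotheses (m1 : 1 < m) (mf : measurable_fun setT f)
  (mxi : measurable_fun setT xi) (meta : measurable_fun setT eta).

Let psi x : R := Num.sqrt (xi x ^+ 2 + eta x ^+ 2).
Let F x := `|f x| `^ (2 * m).
Let Psi x := psi x `^ (2 * m).
Let H (e : R) x := ((f x + e * xi x) ^+ 2 + (e * eta x) ^+ 2) `^ m.
Let A x := f x * `|f x| `^ (2 * m - 2) * xi x.
Let C x := `|f x| `^ (2 * m - 2) * xi x ^+ 2.
Let E x := `|f x| `^ (2 * m - 2) * eta x ^+ 2.

Hypotheses (iF : mu.-integrable setT (EFin \o F))
  (iPsi : mu.-integrable setT (EFin \o Psi)).

Let psi_ge0 x : 0 <= psi x. Proof. exact: sqrtr_ge0. Qed.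

Let CE_ge0 x : 0 <= C x /\ 0 <= E x.
Proof. by split; rewrite mulr_ge0 ?powR_ge0 ?sqr_ge0. Qed.

Let iFP : mu.-integrable setT
  (EFin \o (fun x => (2 * m - 2) / (2 * m) * F x + 2 / (2 * m) * Psi x)).
Proof.
have := @Rintegral_comb _ _ _ mu [:: ((2 * m - 2) / (2 * m), F); (2 / (2 * m), Psi)].
by case=> // + _; under eq_fun do rewrite !big_cons big_nil /= addr0.
Qed.

Let mpowf (q : R) : measurable_fun setT (fun x => `|f x| `^ q).
Proof. by apply: measurable_powRT; exact: measurableT_comp. Qed.

Lemma integrable_second_order_re : mu.-integrable setT (EFin \o C).
Proof.
apply: (integrable_dominated _ iFP).
  by apply: measurable_funM => //; exact: measurable_funX.
move=> x; have [C0 E0] := CE_ge0 x; rewrite ger0_norm//.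
by apply: le_trans (second_order_terms_le (f x) (xi x) (eta x) m1); rewrite lerDl.
Qed.

Let iC := integrable_second_order_re.

Lemma integrable_second_order_im : mu.-integrable setT (EFin \o E).
Proof.
apply: (integrable_dominated _ iFP).
  by apply: measurable_funM => //; exact: measurable_funX.
move=> x; have [C0 E0] := CE_ge0 x; rewrite ger0_norm//.
by apply: le_trans (second_order_terms_le (f x) (xi x) (eta x) m1); rewrite lerDr.
Qed.

Lemma integrable_first_order_term : mu.-integrable setT (EFin \o A).
Proof.
have iFC : mu.-integrable setT (EFin \o (fun x => F x + C x)).
  have := @Rintegral_comb _ _ _ mu [:: (1, F); (1, C)].
  by case=> // + _; under eq_fun do rewrite !big_cons big_nil /= !mul1r addr0.
apply: (integrable_dominated _ iFC).
  by apply: measurable_funM => //; exact: measurable_funM.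
by move=> x; exact: first_order_term_le.
Qed.

Lemma integrable_modulus_powR (e : R) : mu.-integrable setT (EFin \o H e).
Proof.
have := @Rintegral_comb _ _ _ mu [:: ((1 + `|e|) `^ (2 * m - 1), F);
  ((1 + `|e|) `^ (2 * m - 1) * `|e|, Psi)].
case=> // + _; under eq_fun do rewrite !big_cons big_nil /= addr0.
move=> iS; apply: (integrable_dominated _ iS).
  apply: measurable_powRT; apply: measurable_funD; apply: measurable_funX.
    by apply: measurable_funD => //; exact: measurable_funM.
  exact: measurable_funM.
move=> x; rewrite ger0_norm ?powR_ge0//.
apply: (le_trans (modulus_powR_le e (f x) (xi x) (eta x) m1)).
by rewrite mulrDr mulrA.
Qed.

Let iE := integrable_second_order_im.
Let iA := integrable_first_order_term.
Let iH := integrable_modulus_powR.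

Hypotheses (nF : \int[mu]_x F x = 1) (nPsi : \int[mu]_x Psi x = 1).

Lemma second_order_terms_Rintegral_le : \int[mu]_x C x + \int[mu]_x E x <= 1.
Proof.
have := @Rintegral_comb_ge0 _ _ _ mu [:: ((2 * m - 2) / (2 * m), F);
  (2 / (2 * m), Psi); (-1, C); (-1, E)].
rewrite !big_cons big_nil /= nF nPsi => /(_ _ _)/wrap[//|x|].
  rewrite !big_cons big_nil /=.
  have := second_order_terms_le (f x) (xi x) (eta x) m1.
  rewrite -subr_ge0; congr (_ <= _); rewrite /C /E /F /Psi /psi; ring.
rewrite -[X in _ -> is_true X]subr_ge0; congr (_ <= _); field.
by rewrite gt_eqF// (lt_trans ltr01).
Qed.

Lemma second_order_terms_Rintegral_ge0 : 0 <= \int[mu]_x C x /\ 0 <= \int[mu]_x E x.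
Proof. by split; apply: Rintegral_ge0 => x _; case: (CE_ge0 x). Qed.

Lemma first_order_term_Rintegral_sqr : (\int[mu]_x A x) ^+ 2 <= \int[mu]_x C x.
Proof.
set a := \int[mu]_x A x.
have := @Rintegral_comb_ge0 _ _ _ mu [:: (1, C); (- (2 * a), A); (a ^+ 2, F)].
rewrite !big_cons big_nil /= nF -/a => /(_ _ _)/wrap[//|x|].
  rewrite !big_cons big_nil /=.
  have := first_order_term_quadratic (f x) (xi x) a m1.
  congr (_ <= _); rewrite /C /A /F; ring.
rewrite -[X in _ -> is_true X]subr_ge0; congr (_ <= _); ring.
Qed.

Lemma modulus_Rintegral_ge (e : R) : 0 < 1 + e * \int[mu]_x A x ->
  (1 + e * \int[mu]_x A x) `^ (2 * m) <= \int[mu]_x H e x.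
Proof.
set a := \int[mu]_x A x; set t := 1 + e * a => t0.
have tp : 0 < t `^ (2 * m) by rewrite powR_gt0.
have m0 : m != 0 by rewrite gt_eqF// (lt_trans ltr01).
have := @Rintegral_comb_ge0 _ _ _ mu [:: ((2 * m - 1) / (2 * m) - 1 / t, F);
  (1 / (2 * m) / t `^ (2 * m), H e); (- (e / t), A)].
rewrite !big_cons big_nil /= nF -/a => /(_ _ _)/wrap[//|x|].
  rewrite !big_cons big_nil /=.
  have := duality_young e (f x) (xi x) (eta x) m1 t0.
  by rewrite -subr_ge0; congr (_ <= _); rewrite /H /A /F; field; rewrite m0 !gt_eqF.
have -> : ((2 * m - 1) / (2 * m) - 1 / t) * 1 +
   (1 / (2 * m) / t `^ (2 * m) * \int[mu]_x H e x + (- (e / t) * a + 0)) =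
  1 / (2 * m) / t `^ (2 * m) * (\int[mu]_x H e x - t `^ (2 * m)).
  rewrite /t in t0 tp *; field.
  by rewrite m0 !gt_eqF.
rewrite pmulr_rge0 ?subr_ge0// divr_gt0// divr_gt0// mulr_gt0//.
exact: lt_trans m1.
Qed.

Lemma modulus_Rintegral_le (e : R) : \int[mu]_x H e x <= (1 + `|e|) `^ (2 * m).
Proof.
set B := (1 + `|e|) `^ (2 * m - 1).
have := @Rintegral_comb_ge0 _ _ _ mu [:: (B, F); (B * `|e|, Psi); (-1, H e)].
rewrite !big_cons big_nil /= nF nPsi => /(_ _ _)/wrap[//|x|].
  rewrite !big_cons big_nil /=.
  have := modulus_powR_le e (f x) (xi x) (eta x) m1.
  rewrite -subr_ge0; congr (_ <= _); rewrite /H /F /Psi /psi /B; ring.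
rewrite -(@mulr_powRB1 _ (1 + `|e|) (2 * m)) -/B.
- by rewrite -[X in _ -> is_true X]subr_ge0; congr (_ <= _); ring.
- by rewrite addr_ge0.
- by rewrite mulr_gt0// (lt_trans ltr01).
Qed.

(* F and Psi have integral 1, so the bracket in [young_mean] integrates to 1. *)
Let comb_young (q e : R) (G : T -> R) (c : R) : 0 < q < 2 * m ->
  mu.-integrable setT (EFin \o G) -> 0 <= c ->
  (forall x, G x <= c * ((`|e| * psi x) `^ q * (`|f x| + `|e| * psi x) `^ (2 * m - q))) ->
  \int[mu]_x G x <= c * (`|e| `^ q * (1 + `|e|) `^ (2 * m - q)).
Proof.
move=> hq iG c0 Gle; have e0 := normr_ge0 e.
have p1 : 1 <= 2 * m by rewrite -[leLHS]mul1r ler_pM// ?ler1n// ltW.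
have p0 : m != 0 by rewrite gt_eqF// (lt_trans ltr01).
have e1 : 1 + `|e| != 0 by rewrite gt_eqF// ltr_wpDr.
set D := c * (_ * _).
have := @Rintegral_comb_ge0 _ _ _ mu [:: (D * ((2 * m - q) / (2 * m) * (1 + `|e|)^-1), F);
  (D * (q / (2 * m) + (2 * m - q) / (2 * m) * (1 + `|e|)^-1 * `|e|), Psi); (-1, G)].
rewrite !big_cons big_nil /= nF nPsi => /(_ _ _)/wrap[//|x|].
  rewrite !big_cons big_nil /=.
  have := ler_wpM2l c0 (young_mean p1 hq e0 (normr_ge0 (f x)) (psi_ge0 x)).
  move=> /(le_trans (Gle x)).
  by rewrite -subr_ge0; congr (_ <= _); rewrite /F /Psi /D; field; rewrite p0 e1.
rewrite -[X in _ -> is_true X]subr_ge0; congr (_ <= _); field.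
by rewrite p0 e1.
Qed.

Let psiZ (e : R) x : Num.sqrt ((e * xi x) ^+ 2 + (e * eta x) ^+ 2) = `|e| * psi x.
Proof. by rewrite !exprMn -mulrDr sqrtrM ?sqr_ge0// sqrtr_sqr. Qed.

Lemma modulus_Rintegral_first_order (e : R) :
  \int[mu]_x H e x - 1 - 2 * m * (e * \int[mu]_x A x) <=
  m * (2 * m - 1) * (`|e| `^ 2 * (1 + `|e|) `^ (2 * m - 2)).
Proof.
have /(_ _)/wrap[/=//|[iG GE]] :=
  @Rintegral_comb _ _ _ mu [:: (1, H e); (-1, F); (- (2 * m * e), A)].
have -> : \int[mu]_x H e x - 1 - 2 * m * (e * \int[mu]_x A x) =
    \int[mu]_x (\sum_(cg <- [:: (1, H e); (-1, F); (- (2 * m * e), A)]) cg.1 * cg.2 x).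
  by rewrite GE !big_cons big_nil /= nF; ring.
apply: comb_young => //.
- by apply/andP; split; rewrite // -[ltLHS]mulr1 ltr_pM2l.
- rewrite mulr_ge0 ?subr_ge0//; first by rewrite ltW// (lt_trans ltr01).
  by rewrite -[leLHS]mul1r ler_pM// ?ler1n// ltW.
move=> x; rewrite !big_cons big_nil /=.
have := first_order_le (f x) (e * xi x) (e * eta x) m1.
rewrite psiZ -(powR_mulrn 2 (mulr_ge0 (normr_ge0 e) (psi_ge0 x))); apply: le_trans.
by rewrite le_eqVlt; apply/orP; left; apply/eqP; rewrite /H /F /A; ring.
Qed.

Let second_order_young (q e c : R) : 0 < q < 2 * m -> 0 <= c ->
  (forall f x y : R, let r := Num.sqrt (x ^+ 2 + y ^+ 2) in
   `|((f + x) ^+ 2 + y ^+ 2) `^ m - `|f| `^ (2 * m)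
    - 2 * m * (f * `|f| `^ (2 * m - 2) * x)
    - m * ((2 * m - 1) * (`|f| `^ (2 * m - 2) * x ^+ 2)
           + `|f| `^ (2 * m - 2) * y ^+ 2)| <=
   c * (r `^ q * (`|f| + r) `^ (2 * m - q))) ->
  `|\int[mu]_x H e x - 1 - 2 * m * (e * \int[mu]_x A x)
    - m * e ^+ 2 * ((2 * m - 1) * \int[mu]_x C x + \int[mu]_x E x)| <=
  c * (`|e| `^ q * (1 + `|e|) `^ (2 * m - q)).
Proof.
move=> hq c0 hc.
(* [k] is a sign: 1 and -1 give the two halves of the absolute value by the same argument. *)
pose s : R -> seq (R * (T -> R)) := fun k => [:: (k, H e); (- k, F);
  (- (k * (2 * m * e)), A); (- (k * (m * e ^+ 2 * (2 * m - 1))), C);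
  (- (k * (m * e ^+ 2)), E)].
have sP k : `|k| = 1 -> k * (\int[mu]_x H e x - 1 - 2 * m * (e * \int[mu]_x A x)
    - m * e ^+ 2 * ((2 * m - 1) * \int[mu]_x C x + \int[mu]_x E x)) <=
    c * (`|e| `^ q * (1 + `|e|) `^ (2 * m - q)).
  move=> k1; have /(_ _)/wrap[/=//|[iG GE]] := @Rintegral_comb _ _ _ mu (s k).
  rewrite [leLHS](_ : _ = \int[mu]_x (\sum_(cg <- s k) cg.1 * cg.2 x)); last first.
    by rewrite GE !big_cons big_nil /= nF; ring.
  apply: comb_young => // x; rewrite !big_cons big_nil /=.
  have := hc (f x) (e * xi x) (e * eta x); rewrite /= psiZ; apply: le_trans.
  rewrite -[leRHS]mul1r -[X in _ <= X * _]k1 -normrM; apply: le_trans (ler_norm _).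
  by rewrite le_eqVlt; apply/orP; left; apply/eqP; rewrite /H /F /A /C /E; ring.
have := sP 1 (normr1 _); have := sP (-1) (normrN1 _).
by rewrite mul1r mulN1r ler_norml => h1 ->; rewrite andbT lerNl.
Qed.

Lemma modulus_Rintegral_second_order_ge4 (e : R) : 2 <= m ->
  `|\int[mu]_x H e x - 1 - 2 * m * (e * \int[mu]_x A x)
    - m * e ^+ 2 * ((2 * m - 1) * \int[mu]_x C x + \int[mu]_x E x)| <=
  2 * m * (2 * m - 1) * (2 * m - 2) / 6 * (`|e| `^ 3 * (1 + `|e|) `^ (2 * m - 3)).
Proof.
move=> m2; apply: second_order_young; last by move=> *; exact: second_order_le_ge4.
- by apply/andP; split; lra.
- by rewrite mulr_ge0// mulr_ge0//; [rewrite mulr_ge0//|]; lra.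
Qed.

Lemma modulus_Rintegral_second_order_le4 (e : R) : m <= 2 ->
  `|\int[mu]_x H e x - 1 - 2 * m * (e * \int[mu]_x A x)
    - m * e ^+ 2 * ((2 * m - 1) * \int[mu]_x C x + \int[mu]_x E x)| <=
  2 * m * (`|e| `^ (m + 1) * (1 + `|e|) `^ (m - 1)).
Proof.
move=> m2; have mE : 2 * m - (m + 1) = m - 1 by ring.
rewrite -[in leRHS]mE; apply: second_order_young.
- by move: (m1) => m1'; apply/andP; split; lra.
- by rewrite mulr_ge0// ltW// (lt_trans ltr01).
- by move=> ? ? ? /=; rewrite mE; apply: second_order_le_le4; rewrite m1.
Qed.
End IntegralExpansion.

(** * From the p-th power of the norm to its square *)

Section SmallExponent.
Context {R : realType}.
Implicit Types (a b e k m u x y z L P Q : R).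

Lemma powR_dist_ge m x y b : 1 <= m -> 0 <= b -> b <= x -> b <= y ->
  m * b `^ (m - 1) * `|x - y| <= `|x `^ m - y `^ m|.
Proof.
move=> m1 b0.
wlog xy : x y / x <= y => [H|] bx by_.
  have [xy|/ltW xy] := leP x y; first exact: H.
  by rewrite distrC [leRHS]distrC; apply: H.
rewrite distrC [leRHS]distrC ger0_norm ?subr_ge0//.
have x0 : 0 <= x := le_trans b0 bx.
have xy_m : x `^ m <= y `^ m.
  by rewrite ge0_ler_powR ?nnegrE//; [exact: le_trans m1|exact: le_trans xy].
rewrite ger0_norm ?subr_ge0// lerBrDl.
apply: le_trans (powR_tangent m1 x0 (le_trans x0 xy)).
rewrite lerD2l ler_wpM2r ?subr_ge0// ler_wpM2l ?(le_trans ler01)//.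
by rewrite ge0_ler_powR ?nnegrE ?subr_ge0.
Qed.

Lemma remainder_crude m e a L P : `|e| <= 1 -> a ^+ 2 <= 1 ->
  a ^+ 2 <= L -> L <= 2 * m - 1 -> (1 + e * a) ^+ 2 <= P ->
  P - 1 - 2 * (e * a) <= (2 * m - 1) * (`|e| ^+ 2 * (1 + `|e|) `^ (2 * m - 2)) ->
  - ((2 * m - 1) * `|e| ^+ 2) <= P - 1 - 2 * (e * a) - L * e ^+ 2 <=
  (2 * m - 1) * (`|e| ^+ 2 * (1 + `|e|) `^ (2 * m - 2)).
Proof.
move=> e1 a1 aL Lm Plo Pup; have := real_normK (num_real e).
move: `|e| e1 Pup => z; set E := _ `^ _ => z1 Pup ze.
have e20 : 0 <= e ^+ 2 by exact: sqr_ge0.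
have : 0 <= (2 * m - 1 - L) * e ^+ 2 by rewrite mulr_ge0// subr_ge0.
have : 0 <= L * e ^+ 2 by rewrite mulr_ge0// (le_trans _ aL)// sqr_ge0.
have : 0 <= a ^+ 2 * e ^+ 2 by rewrite mulr_ge0// sqr_ge0.
move=> h1 h2 h3; apply/andP; split; last by lra.
rewrite ze; lra.
Qed.

(** The tangent bound at the reciprocal base gives (1/6)^k <= 1 - s with s = 5 k / 6, and (1 + s) (1
    - s) <= 1. *)
Lemma powR6_ge k : 0 <= k <= 1 -> 1 + 5 / 6 * k <= 6 `^ k.
Proof.
move=> /andP[k0 k1].
have h : (6^-1 : R) `^ k <= 1 + k * (6^-1 - 1) by apply: powR_le_tangent; lra.
have h1 : (6 : R) `^ k * 6^-1 `^ k = 1 by rewrite -powRM// mulfV// powR1.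
have p6 : 0 < (6 : R) `^ k by rewrite powR_gt0.
have h2 : 1 <= (6 : R) `^ k * (1 - 5 / 6 * k).
  by rewrite -[leLHS]h1 ler_wpM2l ?powR_ge0//; lra.
have : 0 <= 25 / 36 * k ^+ 2 by rewrite mulr_ge0// sqr_ge0.
have : 0 < 1 - 5 / 6 * k by lra.
move=> h3 h4; rewrite -(ler_pM2r h3); lra.
Qed.

(** The base 3 p / (p - 2) = 3 m / (m - 1) decreases to 6 at p = 4. The remaining estimates use only
    this smaller constant, which stays bounded as p tends to 2. *)
Lemma kappa_ge m : 1 < m <= 2 ->
  4 * (2 * m - 1) / (m * (m + 1)) * (8 * (m - 1) + 6 `^ (m - 1)) <=
  16 * (2 * m - 1) / (2 * m * (2 * m + 2)) *
    (4 * (2 * m - 2) + (3 * (2 * m) / (2 * m - 2)) `^ (2 * m / 2 - 1)).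
Proof.
move=> /andP[m1 m2].
have -> : 16 * (2 * m - 1) / (2 * m * (2 * m + 2)) = 4 * (2 * m - 1) / (m * (m + 1)).
  by field; rewrite !gt_eqF//; lra.
rewrite (_ : 2 * m / 2 - 1 = m - 1); last by field.
rewrite ler_wpM2l//; first by rewrite divr_ge0// mulr_ge0//; lra.
have -> : 4 * (2 * m - 2) = 8 * (m - 1) by ring.
rewrite lerD2l ge0_ler_powR ?nnegrE//; first by lra.
- by rewrite divr_ge0//; lra.
- by rewrite ler_pdivlMr//; lra.
Qed.

Lemma remainder_mid_le4 m z k : 1 < m <= 2 -> 1 / 4 <= z <= 1 ->
  4 * (2 * m - 1) / (m * (m + 1)) * (8 * (m - 1) + 6 `^ (m - 1)) <= k ->
  (2 * m - 1) * (z ^+ 2 * (1 + z) `^ (2 * m - 2)) <= k * z `^ (m + 1).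
Proof.
move=> /andP[m1 m2] /andP[z4 z1] hk.
have z0 : 0 < z by lra.
have -> : z `^ (m + 1) = z ^+ 2 * z `^ (m - 1).
  rewrite -(powR_mulrn 2 (ltW z0)) -powRD; first by congr (_ `^ _); ring.
  by rewrite (gt_eqF z0) implybT.
have h1 : (1 + z) `^ (2 * m - 2) <= (25 / 4) `^ (m - 1) * z `^ (m - 1).
  have p0 : 0 <= 25 / 4 :> R by rewrite divr_ge0.
  rewrite -(powRM (m - 1) p0 (ltW z0)).
  rewrite (_ : 2 * m - 2 = 2 * (m - 1)); last by ring.
  have z1' : 0 <= 1 + z by lra.
  rewrite -[1 + z](ger0_norm z1') -powR_sqr.
  (* 25/4 is the maximum of (1 + z)^2 / z on [1/4, 1], attained at z = 1/4. *)
  have hz : (1 + z) ^+ 2 <= 25 / 4 * z.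
    have : 0 <= (z - 1 / 4) * (1 - z) by rewrite mulr_ge0//; lra.
    lra.
  by rewrite ge0_ler_powR ?nnegrE ?sqr_ge0//; lra.
have h2 : (25 / 4 : R) `^ (m - 1) <= 1 + (m - 1) * (25 / 4 - 1).
  by apply: powR_le_tangent; lra.
have h3 : 1 + 5 / 6 * (m - 1) <= 6 `^ (m - 1) by apply: powR6_ge; lra.
have h4 : (2 * m - 1) * (25 / 4) `^ (m - 1) <= k.
  apply: le_trans hk.
  rewrite -mulrA [4 * (2 * m - 1)]mulrC -mulrA ler_wpM2l//; first by lra.
  rewrite mulrCA ler_pdivlMl; last by rewrite mulr_gt0//; lra.
  have h5 : m * (m + 1) * (25 / 4) `^ (m - 1) <= m * (m + 1) * (1 + (m - 1) * (25 / 4 - 1)).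
    by rewrite ler_wpM2l// mulr_ge0//; lra.
  apply: (le_trans h5).
  have : m * (m + 1) * (1 + (m - 1) * (25 / 4 - 1)) <=
    4 * (8 * (m - 1) + (1 + 5 / 6 * (m - 1))).
    have k1 : 0 <= (m - 1) * (2 - m) by rewrite mulr_ge0//; lra.
    have k2 : 0 <= (m - 1) * ((m - 1) * (2 - m)) by rewrite mulr_ge0//; lra.
    clear -m1 m2 k1 k2; lra.
  clear -h3; lra.
have h6 : z ^+ 2 * (1 + z) `^ (2 * m - 2) <= z ^+ 2 * ((25 / 4) `^ (m - 1) * z `^ (m - 1)).
  by rewrite ler_wpM2l ?sqr_ge0.
have h7 : (2 * m - 1) * (25 / 4) `^ (m - 1) * (z ^+ 2 * z `^ (m - 1)) <=
    k * (z ^+ 2 * z `^ (m - 1)).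
  by rewrite ler_wpM2r// mulr_ge0 ?sqr_ge0 ?powR_ge0.
apply: le_trans h7.
have : (2 * m - 1) * (z ^+ 2 * (1 + z) `^ (2 * m - 2)) <=
  (2 * m - 1) * (z ^+ 2 * ((25 / 4) `^ (m - 1) * z `^ (m - 1))).
  by rewrite ler_wpM2l//; lra.
move=> /le_trans; apply.
by rewrite le_eqVlt; apply/orP; left; apply/eqP; ring.
Qed.
End SmallExponent.

Section SmallExponentFine.
Context {R : realType}.
Implicit Types (a b e k m u x y z L P Q : R).

(** For |e| <= 1/4 the common lower bound (1 - |e|)^2 of P and P0 is at least 9/16, so passing from
    m-th powers to P - P0 costs nothing. *)
Lemma mul_powR_ge1 m x : 1 <= m <= 2 -> 9 / 16 <= x <= 1 -> 1 <= m * x `^ (m - 1).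
Proof.
move=> /andP[m1 m2] /andP[x1 x2].
have x0 : 0 < x by lra.
have V0 : 0 < x^-1 by rewrite invr_gt0.
have h : x^-1 `^ (m - 1) <= 1 + (m - 1) * (x^-1 - 1) by apply: powR_le_tangent; lra.
have xV : x^-1 <= 2 by rewrite -[x^-1]mul1r ler_pdivrMr//; lra.
have h1 : x^-1 `^ (m - 1) <= m.
  apply: (le_trans h); have : 0 <= (m - 1) * (2 - x^-1) by rewrite mulr_ge0//; lra.
  lra.
have xx : x^-1 `^ (m - 1) * x `^ (m - 1) = 1.
  by rewrite -powRM ?ltW// mulVf ?powR1// gt_eqF.
by rewrite -[leLHS]xx ler_wpM2r ?powR_ge0.
Qed.

Lemma powR_remainder3_le m u : 1 <= m <= 2 -> - 1 <= u ->
  `|(1 + u) `^ m - 1 - m * u - m * (m - 1) / 2 * u ^+ 2| <=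
  (m - 1) * (2 - m) / 2 * `|u| ^+ 3.
Proof.
move=> m12 u1; have /andP[m1 m2] := m12.
have a2 : 0 <= (m - 1) * (2 - m) by rewrite mulr_ge0//; lra.
have [u0|/ltW u0] := leP 0 u.
  have u1' : 1 <= 1 + u by lra.
  have hi := powR_second_order_le_right12 m12 u1'.
  have lo := powR_third_order_ge_right12 m12 u1'.
  have u3 : 0 <= (m - 1) * (2 - m) * u ^+ 3 by rewrite mulr_ge0// exprn_ge0.
  have u3' : 0 <= (2 - m) * ((m - 1) * (2 - m) * u ^+ 3) by rewrite mulr_ge0//; lra.
  rewrite (ger0_norm u0) ler_norml; clear -hi lo u3 u3'; lra.
have u1' : 0 <= 1 + u <= 1 by lra.
have lo := powR_second_order_ge_left12 m12 u1'.
have hi := powR_third_order_le_left12 m12 u1'.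
have u3 : 0 <= (m - 1) * (2 - m) * (- u) ^+ 3 by rewrite mulr_ge0// exprn_ge0//; lra.
rewrite (ler0_norm u0) ler_norml; clear -hi lo u3; lra.
Qed.

(** The left side multiplies (m - 1) |e|^3 / 2 in the cubic error of [remainder_fine_le4]; it equals
    57/2 at m = 2. *)
Lemma cubic_coeff_le m : 1 <= m <= 2 ->
  m * (2 * m - 1) * (4 + (2 * m - 1) / 4) + (2 - m) * (2 + (2 * m - 1) / 4) ^+ 3 <= 29.
Proof.
move=> /andP[m1 m2].
have k1 : 0 <= (m - 1) * (2 - m) by rewrite mulr_ge0//; lra.
have k2 : 0 <= (2 - m) ^+ 2 * (m + 1) by rewrite mulr_ge0 ?sqr_ge0//; lra.
have k3 : 0 <= (m - 1) ^+ 4 by rewrite exprn_ge0//; lra.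
clear -m1 m2 k1 k2 k3; lra.
Qed.

Lemma remainder_fine_le4 m e a L Q k : 1 < m <= 2 -> `|e| <= 1 / 4 ->
  a ^+ 2 <= 1 -> a ^+ 2 <= L -> L <= 2 * m - 1 -> 0 <= Q ->
  (1 + e * a) ^+ 2 <= Q `^ m^-1 ->
  `|Q - 1 - 2 * m * (e * a) - m * e ^+ 2 * (L + (2 * m - 2) * a ^+ 2)| <=
    2 * m * (`|e| `^ (m + 1) * (1 + `|e|) `^ (m - 1)) ->
  4 * (2 * m - 1) / (m * (m + 1)) * (8 * (m - 1) + 6 `^ (m - 1)) <= k ->
  `|Q `^ m^-1 - 1 - 2 * (e * a) - L * e ^+ 2| <= k * `|e| `^ (m + 1).
Proof.
move=> m12 e4 a1 aL Lm Q0 Plo Qr hk; have /andP[m1 m2] := m12.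
have m12' : 1 <= m <= 2 by rewrite ltW.
set P := Q `^ m^-1 in Plo *.
have m0 : m != 0 by rewrite gt_eqF// (lt_trans ltr01).
have PQ : P `^ m = Q by rewrite -powRrM mulVf// powRr1.
have z0 := normr_ge0 e; have ze := real_normK (num_real e).
set z := `|e| in e4 Qr z0 ze *; set Y := z `^ (m + 1) in Qr *.
have na : `|a| <= 1 by rewrite -(@ler_sqr _ `|a| 1) ?nnegrE// real_normK ?num_real// expr1n.
have nea : `|e * a| <= z by rewrite normrM ler_piMr.
have /andP[ea1 ea2] : - z <= e * a <= z by rewrite -ler_norml.
have L0 : 0 <= L by rewrite (le_trans _ aL)// sqr_ge0.
have z20 : 0 <= z ^+ 2 by exact: sqr_ge0.
set u := 2 * (e * a) + L * e ^+ 2.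
have ulo : (1 + e * a) ^+ 2 <= 1 + u.
  have : 0 <= (L - a ^+ 2) * e ^+ 2 by rewrite mulr_ge0 ?sqr_ge0// subr_ge0.
  rewrite /u; clear; lra.
have bz : (1 - z) ^+ 2 <= (1 + e * a) ^+ 2.
  by rewrite lerXn2r// ?nnegrE; clear -ea1 ea2 e4 z0; lra.
have b0 : 0 <= (1 - z) ^+ 2 by exact: sqr_ge0.
have dist := powR_dist_ge (ltW m1) b0 (le_trans bz Plo) (le_trans bz ulo).
have bm : 1 <= m * ((1 - z) ^+ 2) `^ (m - 1).
  apply: mul_powR_ge1 => //.
  have : 0 <= (1 / 4 - z) * (7 / 4 - z) by rewrite mulr_ge0//; clear -e4; lra.
  have : 0 <= z * (2 - z) by rewrite mulr_ge0//; clear -e4; lra.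
  clear => h1 h2; apply/andP; split; lra.
have -> : P - 1 - 2 * (e * a) - L * e ^+ 2 = P - (1 + u) by rewrite /u; ring.
have {}dist : `|P - (1 + u)| <= `|Q - (1 + u) `^ m|.
  by rewrite -PQ; apply: le_trans dist; rewrite ler_peMl.
apply: (le_trans dist).
have u1 : -1 <= u by move: (le_trans b0 (le_trans bz ulo)); clear; lra.
have R3 := powR_remainder3_le m12' u1.
have nu : `|u| <= z * (2 + (2 * m - 1) / 4).
  rewrite /u; apply: (le_trans (ler_normD _ _)).
  rewrite normrM (ger0_norm (_ : 0 <= 2))// (ger0_norm (_ : 0 <= L * e ^+ 2)); last first.
    by rewrite mulr_ge0 ?sqr_ge0.
  have : L * e ^+ 2 <= (2 * m - 1) * (z * (1 / 4)).
    apply: ler_pM => //; first by rewrite sqr_ge0.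
    by rewrite -ze expr2 ler_wpM2l.
  clear -nea; lra.
have u3 : `|u| ^+ 3 <= (z * (2 + (2 * m - 1) / 4)) ^+ 3.
  rewrite lerXn2r// ?nnegrE// mulr_ge0//; clear -m1; lra.
have a0 : 0 <= m - 1 by rewrite subr_ge0 ltW.
have b20 : 0 <= 2 - m by rewrite subr_ge0.
have mm0 : 0 <= m := ltW (lt_trans ltr01 m1).
have u3' : (m - 1) * (2 - m) / 2 * `|u| ^+ 3 <=
    (m - 1) * (2 - m) / 2 * (z * (2 + (2 * m - 1) / 4)) ^+ 3.
  by rewrite ler_wpM2l// divr_ge0// mulr_ge0.
(* W = u^2 - 4 (e a)^2: the expansion of (1 + u)^m contains u^2 where that of Q has only its part of
   order e^2. *)
set W := 4 * (e * a) * (L * e ^+ 2) + (L * e ^+ 2) ^+ 2.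
have nW : `|W| <= z ^+ 3 * ((2 * m - 1) * (4 + (2 * m - 1) / 4)).
  have Le0 : 0 <= L * e ^+ 2 by rewrite mulr_ge0 ?sqr_ge0.
  have Lz : L * e ^+ 2 <= (2 * m - 1) * z ^+ 2 by rewrite -ze ler_wpM2r.
  have Lz1 : L * e ^+ 2 <= (2 * m - 1) * (z * (1 / 4)).
    apply: (le_trans Lz); rewrite ler_wpM2l//; first by clear -m1; lra.
    by rewrite expr2 ler_wpM2l.
  have h : `|4 * (e * a) + L * e ^+ 2| <= z * (4 + (2 * m - 1) / 4).
    apply: (le_trans (ler_normD _ _)); rewrite normrM (ger0_norm Le0) ger0_norm//.
    clear -nea Lz1; lra.
  rewrite (_ : W = (4 * (e * a) + L * e ^+ 2) * (L * e ^+ 2)); last by rewrite /W; ring.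
  rewrite normrM (ger0_norm Le0).
  apply: (le_trans (ler_pM (normr_ge0 _) Le0 h Lz)).
  by rewrite le_eqVlt; apply/orP; left; apply/eqP; ring.
have nW' : m * (m - 1) / 2 * `|W| <=
    m * (m - 1) / 2 * (z ^+ 3 * ((2 * m - 1) * (4 + (2 * m - 1) / 4))).
  by rewrite ler_wpM2l// divr_ge0// mulr_ge0.
have z3Y : z ^+ 3 <= Y.
  have [->|zn0] := eqVneq z 0; first by rewrite expr0n/= powR_ge0.
  have zp : 0 < z by rewrite lt_def zn0.
  rewrite -(powR_mulrn 3 z0) /Y ger_powR ?zp//; clear -e4 m2; lra.
have Y0 : 0 <= Y by exact: powR_ge0.
have tri : `|Q - (1 + u) `^ m| <=
   `|Q - 1 - 2 * m * (e * a) - m * e ^+ 2 * (L + (2 * m - 2) * a ^+ 2)| +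
   m * (m - 1) / 2 * `|W| +
   `|(1 + u) `^ m - 1 - m * u - m * (m - 1) / 2 * u ^+ 2|.
  set A := Q - 1 - _ - _; set B := (1 + u) `^ m - 1 - _ - _.
  rewrite (_ : Q - (1 + u) `^ m = A - m * (m - 1) / 2 * W - B); last first.
    by rewrite /A /B /W /u; field.
  apply: (le_trans (ler_normB _ _)); rewrite lerD2r.
  apply: (le_trans (ler_normB _ _)); rewrite lerD2l normrM.
  by rewrite ger0_norm// divr_ge0// mulr_ge0.
have S1 : (1 + z) `^ (m - 1) <= 1 + (m - 1) / 4.
  have : (1 + z) `^ (m - 1) <= 1 + (m - 1) * (1 + z - 1).
    by apply: powR_le_tangent; clear -z0 m1 m2; lra.
  have : 0 <= (m - 1) * (1 / 4 - z) by rewrite mulr_ge0// subr_ge0.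
  clear; lra.
have r1 : 2 * m * (Y * (1 + z) `^ (m - 1)) <= 2 * m * (Y * (1 + (m - 1) / 4)).
  by rewrite ler_wpM2l ?mulr_ge0// ler_wpM2l.
have cc := cubic_coeff_le m12'.
have r2 : m * (m - 1) / 2 * `|W| + (m - 1) * (2 - m) / 2 * `|u| ^+ 3 <=
   (m - 1) * (29 / 2) * Y.
  apply: (@le_trans _ _ ((m - 1) / 2 * z ^+ 3 *
    (m * (2 * m - 1) * (4 + (2 * m - 1) / 4) + (2 - m) * (2 + (2 * m - 1) / 4) ^+ 3))).
    apply: (le_trans (lerD nW' u3')).
    by rewrite le_eqVlt; apply/orP; left; apply/eqP; field.
  apply: (@le_trans _ _ ((m - 1) / 2 * z ^+ 3 * 29)).
    by rewrite ler_wpM2l// mulr_ge0 ?exprn_ge0// divr_ge0.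
  have : (m - 1) * z ^+ 3 <= (m - 1) * Y by rewrite ler_wpM2l.
  clear; lra.
have h6 : 1 + 5 / 6 * (m - 1) <= 6 `^ (m - 1) by apply: powR6_ge; clear -m1 m2; lra.
have hk2 : 16 * (m - 1) + 2 * (1 + 5 / 6 * (m - 1)) <= k.
  apply: le_trans hk.
  have mp : 0 < m * (m + 1) by rewrite mulr_gt0 ?(lt_trans ltr01)//; clear -m1; lra.
  (* Equality at m = 1 and m = 2; the gap has the sign of (m - 1) (2 - m). *)
  have c2 : 2 <= 4 * (2 * m - 1) / (m * (m + 1)).
    rewrite ler_pdivlMr//.
    have : 0 <= (m - 1) * (2 - m) by rewrite mulr_ge0.
    clear; lra.
  apply: (@le_trans _ _ (2 * (8 * (m - 1) + 6 `^ (m - 1)))); first by clear -h6; lra.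
  by rewrite ler_wpM2r// addr_ge0 ?powR_ge0// mulr_ge0.
(* Against the bound in [hk2] this is an equality at m = 1 and reads 39/2 <= 59/3 at m = 2, where
   the slope 5/6 from [powR6_ge] is essential. *)
have hk3 : 2 * m * (1 + (m - 1) / 4) + (m - 1) * (29 / 2) <= k.
  apply: le_trans hk2.
  have : 0 <= (m - 1) * (2 - m) by rewrite mulr_ge0.
  clear -m1 m2; lra.
have := ler_wpM2r Y0 hk3.
clear -tri Qr r1 r2 R3; lra.
Qed.
End SmallExponentFine.

(** * Extraction of the root for p at least 4 *)

Section LargeExponent.
Context {R : realType}.
Implicit Types (a b e k m q t u x y z D L P Q : R).

(** The tangent inequality at exponent - k. It bounds (1 + z)^k in terms of k z only, hence
    uniformly in p. *)
Lemma powR1D_mul_le1 z k : 0 <= z -> 0 <= k -> (1 + z) `^ k * (1 - k * z) <= 1.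
Proof.
move=> z0 k0; have z1 : 0 < 1 + z by lra.
have h : 1 + (- k) * (1 + z - 1) <= (1 + z) `^ (- k).
  by apply: powR_ge_tangent => //; right; rewrite oppr_le0.
have hE : (1 + z) `^ k * (1 + z) `^ (- k) = 1.
  by rewrite -powRD; [rewrite subrr powRr0|rewrite (gt_eqF z1) implybT].
rewrite -[leRHS]hE ler_wpM2l ?powR_ge0//; lra.
Qed.

Lemma remainder_mid_ge4 m z : 2 <= m -> 0 <= z -> 9 / 20 <= (2 * m - 1) * z ->
  (2 * m - 1) * z <= 5 / 6 ->
  (2 * m - 1) * (z ^+ 2 * (1 + z) `^ (2 * m - 2)) <=
  4 / 3 * (5 * (2 * m) ^+ 2 - 12 * (2 * m) + 7) * z ^+ 3.
Proof.
move=> m2 z0 x1 x2.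
(* Applied to the full power, [powR1D_mul_le1] would only give 6 when the product is 5/6; the fourth
   root gives (24/19)^4 <= 64/25. *)
set G := (1 + z) `^ ((2 * m - 2) / 4).
have z10 : 0 <= 1 + z by lra.
have GE : (1 + z) `^ (2 * m - 2) = G ^+ 4.
  by rewrite -powR_mulrn ?powR_ge0// -powRrM; congr (_ `^ _); field.
have G0 : 0 <= G by exact: powR_ge0.
have G1 : G <= 24 / 19.
  have : G * (1 - (2 * m - 2) / 4 * z) <= 1 by apply: powR1D_mul_le1 => //; lra.
  have : G * (19 / 24) <= G * (1 - (2 * m - 2) / 4 * z) by rewrite ler_wpM2l//; lra.
  lra.
have G4 : G ^+ 4 <= 64 / 25.
  apply: (@le_trans _ _ ((24 / 19) ^+ 4)); last by lra.
  by rewrite lerXn2r// nnegrE.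
have h1 : z ^+ 2 * G ^+ 4 <= z ^+ 2 * (64 / 25) by rewrite ler_wpM2l ?sqr_ge0.
(* kappa = (4/3) (2 m - 1) (10 m - 7), and 10 m - 7 >= (13/3) (2 m - 1) for m >= 2. So the right
   side is at least (4/3) (13/3) (9/20) = 13/5. *)
have h2 : 64 / 25 <= 4 / 3 * (10 * m - 7) * z.
  have : 0 <= (m - 2) * z by rewrite mulr_ge0//; lra.
  lra.
have h3 : (2 * m - 1) * z ^+ 2 * (64 / 25) <=
    (2 * m - 1) * z ^+ 2 * (4 / 3 * (10 * m - 7) * z).
  by rewrite ler_wpM2l// mulr_ge0 ?sqr_ge0//; lra.
have h4 : (2 * m - 1) * (z ^+ 2 * G ^+ 4) <= (2 * m - 1) * (z ^+ 2 * (64 / 25)).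
  by rewrite ler_wpM2l//; lra.
rewrite GE; clear -h3 h4; lra.
Qed.

(** 4 z is (1 + z)^2 - (1 - z)^2, the distance left by the triangle inequality. The threshold 5/6 is
    chosen so that (4/3) (13/3) (5/6)^2 just exceeds 4. *)
Lemma remainder_far_ge4 m z : 2 <= m -> 0 <= z -> 5 / 6 <= (2 * m - 1) * z ->
  4 * z <= 4 / 3 * (5 * (2 * m) ^+ 2 - 12 * (2 * m) + 7) * z ^+ 3.
Proof.
move=> m2 z0 x1.
have h1 : 13 / 3 * ((2 * m - 1) * z) <= (10 * m - 7) * z.
  have : 0 <= (m - 2) * z by rewrite mulr_ge0//; lra.
  lra.
have h2 : 5 / 6 * (13 / 3 * (5 / 6)) <= (2 * m - 1) * z * ((10 * m - 7) * z).
  by apply: ler_pM => //; lra.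
have := ler_wpM2r z0 h2; lra.
Qed.

Lemma powR_sub1_bound m t z : 2 <= m -> 0 <= z <= 1 -> - z <= t <= z ->
  `|1 - (1 + t) `^ (2 * m - 2)| <= (2 * m - 2) * z * (1 + z) `^ (2 * m - 3).
Proof.
move=> m2 /andP[z0 z1] /andP[t1 t2].
have E1 : 1 <= (1 + z) `^ (2 * m - 3) by apply: powR_ge1; lra.
have p1 : 1 <= 2 * m - 2 by lra.
have t10 : 0 <= 1 + t by lra.
have z10 : 0 <= 1 + z by lra.
have lo := powR_tangent p1 ler01 t10.
rewrite powR1 in lo.
have mono : (1 + t) `^ (2 * m - 2) <= (1 + z) `^ (2 * m - 2).
  by rewrite ge0_ler_powR ?nnegrE//; lra.
have hi := powR_tangent p1 z10 ler01.
rewrite powR1 (_ : 2 * m - 2 - 1 = 2 * m - 3) in hi; last by ring.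
have k0 : 0 <= (2 * m - 2) * z by rewrite mulr_ge0//; lra.
have kE : (2 * m - 2) * z <= (2 * m - 2) * z * (1 + z) `^ (2 * m - 3) by rewrite ler_peMr.
have kt : 0 <= (2 * m - 2) * (t + z) by rewrite mulr_ge0//; lra.
rewrite ler_norml; clear -lo mono hi kE kt; lra.
Qed.

(** Tangents at both ends, at exponents m and m - 1, suffice; this doubles the Taylor constant but
    includes x = 0. *)
Lemma powR_shift_remainder m x u : 2 <= m -> 0 <= x -> 0 <= u ->
  0 <= (x + u) `^ m - x `^ m - m * x `^ (m - 1) * u <=
  m * (m - 1) * (x + u) `^ (m - 2) * u ^+ 2.
Proof.
move=> m2 x0 u0; have xu0 : 0 <= x + u by rewrite addr_ge0.
have m1 : 1 <= m by lra.
have m11 : 1 <= m - 1 by lra.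
have h1 := powR_tangent m1 x0 xu0.
have h2 := powR_tangent m1 xu0 x0.
have h3 := powR_tangent m11 xu0 x0.
rewrite (_ : m - 1 - 1 = m - 2) in h3; last by ring.
have h4 : 0 <= m * u by rewrite mulr_ge0//; lra.
have h5 := ler_wpM2l h4 h3.
apply/andP; split; first by clear -h1; lra.
clear -h2 h5; lra.
Qed.

Lemma powR_base_ge m z : 2 <= m -> 0 <= z -> (2 * m - 1) * z <= 9 / 20 -> z <= 3 / 20 ->
  11 / 20 <= ((1 - z) ^+ 2) `^ (m - 1).
Proof.
move=> m2 z0 x z1; have z10 : 0 <= 1 - z by lra.
rewrite powR_sqr (ger0_norm z10) (_ : 2 * (m - 1) = 2 * m - 2); last by ring.
have : 1 + (2 * m - 2) * (1 - z - 1) <= (1 - z) `^ (2 * m - 2).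
  by apply: powR_ge_tangent; lra.
lra.
Qed.

Lemma powR_growth_le m z : 2 <= m -> 0 <= z -> (2 * m - 1) * z <= 9 / 20 ->
  (1 + z) `^ (2 * m - 3) <= 20 / 11.
Proof.
move=> m2 z0 x; set E := _ `^ _.
have E0 : 0 <= E by exact: powR_ge0.
have : E * (1 - (2 * m - 3) * z) <= 1 by apply: powR1D_mul_le1 => //; lra.
have : E * (11 / 20) <= E * (1 - (2 * m - 3) * z) by rewrite ler_wpM2l//; lra.
lra.
Qed.

(** The perturbation is at most (9/20) z, so y <= (1 + 13 z / 10)^2, and 1 - (13/10) (9/20) =
    83/200. *)
Lemma powR_perturbed_le m z y : 2 <= m -> 0 <= z -> (2 * m - 1) * z <= 9 / 20 ->
  z <= 3 / 20 -> 0 <= y -> y <= (1 + z) ^+ 2 + (2 * m - 1) * z ^+ 2 ->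
  y `^ (m - 2) <= 200 / 83.
Proof.
move=> m2 z0 x z1 y0 hy.
have y1 : y <= (1 + 13 / 10 * z) ^+ 2.
  have h2 : (2 * m - 1) * z ^+ 2 <= 9 / 20 * z by rewrite expr2 mulrA ler_wpM2r.
  have h3 : z ^+ 2 <= 3 / 20 * z by rewrite expr2 ler_wpM2r.
  have := sqr_ge0 z; lra.
have Z0 : 0 <= 13 / 10 * z by lra.
have Z10 : 0 <= 1 + 13 / 10 * z by lra.
apply: (@le_trans _ _ ((1 + 13 / 10 * z) `^ (2 * m - 4))).
  rewrite (_ : 2 * m - 4 = 2 * (m - 2)); last by ring.
  rewrite -[X in _ <= X `^ _](ger0_norm Z10) -powR_sqr.
  by rewrite ge0_ler_powR ?nnegrE ?sqr_ge0 ?subr_ge0.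
set G := _ `^ _.
have G0 : 0 <= G by exact: powR_ge0.
have : G * (1 - (2 * m - 4) * (13 / 10 * z)) <= 1 by apply: powR1D_mul_le1 => //; lra.
have : G * (83 / 200) <= G * (1 - (2 * m - 4) * (13 / 10 * z)).
  by rewrite ler_wpM2l//; lra.
lra.
Qed.

(** P0 = t^2 + D is expanded in D around t^2, not around 1: t^p is itself |1 + z|^p for the real z =
    e a, so it obeys the same error bound as Q, and D >= 0 is of second order. *)
Lemma remainder_fine_ge4 m e a L Q : 2 <= m -> (2 * m - 1) * `|e| <= 9 / 20 ->
  a ^+ 2 <= 1 -> a ^+ 2 <= L -> L <= 2 * m - 1 -> 0 <= Q ->
  (1 + e * a) ^+ 2 <= Q `^ m^-1 ->
  `|Q - 1 - 2 * m * (e * a) - m * e ^+ 2 * (L + (2 * m - 2) * a ^+ 2)| <=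
    2 * m * (2 * m - 1) * (2 * m - 2) / 6 * (`|e| ^+ 3 * (1 + `|e|) `^ (2 * m - 3)) ->
  `|Q `^ m^-1 - 1 - 2 * (e * a) - L * e ^+ 2| <=
    4 / 3 * (5 * (2 * m) ^+ 2 - 12 * (2 * m) + 7) * `|e| ^+ 3.
Proof.
move=> m2 e9 a1 aL Lm Q0 Plo Qr.
have m1 : 1 <= m by lra.
have mp : 0 <= m by lra.
have [q1 q2 q3 q4] : [/\ 0 <= m - 1, 0 <= 2 * m - 1, 0 <= 2 * m - 2 & 0 <= m - 2].
  by split; lra.
set P := Q `^ m^-1 in Plo *.
have m0 : m != 0 by rewrite gt_eqF//; lra.
have PQ : P `^ m = Q by rewrite -powRrM mulVf// powRr1.
have z0 := normr_ge0 e; have ze := real_normK (num_real e).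
have na : `|a| <= 1 by rewrite -(@ler_sqr _ `|a| 1) ?nnegrE// real_normK ?num_real// expr1n.
have nea : `|e * a| <= `|e| by rewrite normrM ler_piMr.
have r2 : `|(1 + e * a) `^ (2 * m) - 1 - 2 * m * (e * a)
    - m * (2 * m - 1) * (e * a) ^+ 2| <=
  2 * m * (2 * m - 1) * (2 * m - 2) / 6 * (`|e| ^+ 3 * (1 + `|e|) `^ (2 * m - 3)).
  have := modulus_powR_second_order_ge4 m2 (lexx `|e * a|).
  rewrite real_normK ?num_real//.
  rewrite (_ : 1 + 2 * (e * a) + (e * a) ^+ 2 = (1 + e * a) ^+ 2); last by ring.
  have t0 : 0 <= 1 + e * a.
    have : 0 <= (m - 2) * `|e| by rewrite mulr_ge0//; lra.
    move: nea; rewrite ler_norml => /andP[h _]; lra.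
  rewrite powR_sqr (ger0_norm t0) => h.
  rewrite (_ : m * (2 * m - 1) * (e * a) ^+ 2 =
    m * ((e * a) ^+ 2 + 2 * (m - 1) * (e * a) ^+ 2)); last by ring.
  apply: (le_trans h); rewrite ler_wpM2l//.
    by rewrite divr_ge0// !mulr_ge0.
  apply: ler_pM; rewrite ?exprn_ge0 ?powR_ge0//; first by rewrite lerXn2r ?nnegrE.
  have A1 : 0 <= 1 + `|e * a| by rewrite addr_ge0.
  have A2 : 0 <= 1 + `|e| by rewrite addr_ge0.
  by rewrite ge0_ler_powR ?nnegrE ?lerD2l//; lra.
set z := `|e| in e9 Qr r2 nea z0 ze *.
have /andP[ea1 ea2] : - z <= e * a <= z by rewrite -ler_norml.
have z1 : z <= 3 / 20 by have : 0 <= (m - 2) * z by [rewrite mulr_ge0//; lra]; lra.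
set C := _ / 6 in Qr r2; set E := (1 + z) `^ (2 * m - 3) in Qr r2.
set t := 1 + e * a in Plo r2.
have t0 : 1 - z <= t by rewrite /t; lra.
have t00 : 0 <= t by lra.
set D := (L - a ^+ 2) * e ^+ 2.
have D0 : 0 <= D by rewrite mulr_ge0 ?sqr_ge0// subr_ge0.
have a20 : 0 <= a ^+ 2 by exact: sqr_ge0.
have z20 : 0 <= z ^+ 2 by exact: sqr_ge0.
have Dz : D <= (2 * m - 1) * z ^+ 2.
  by rewrite /D -ze ler_wpM2r//; lra.
have PtE : 1 + 2 * (e * a) + L * e ^+ 2 = t ^+ 2 + D by rewrite /t /D; ring.
have bz : (1 - z) ^+ 2 <= t ^+ 2 by rewrite lerXn2r// ?nnegrE; lra.
have b0 : 0 <= (1 - z) ^+ 2 by exact: sqr_ge0.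
have bD : (1 - z) ^+ 2 <= t ^+ 2 + D by rewrite (le_trans bz)// lerDl.
have dist := powR_dist_ge m1 b0 (le_trans bz Plo) bD.
rewrite PQ in dist.
have -> : P - 1 - 2 * (e * a) - L * e ^+ 2 = P - (t ^+ 2 + D) by rewrite -PtE; ring.
have bm := powR_base_ge m2 z0 e9 z1.
have E0 : 0 <= E by exact: powR_ge0.
have E1 : E <= 20 / 11 := powR_growth_le m2 z0 e9.
have Y1 : (t ^+ 2 + D) `^ (m - 2) <= 200 / 83.
  apply: (powR_perturbed_le m2 z0 e9 z1); first by rewrite addr_ge0 ?sqr_ge0.
  by rewrite lerD// lerXn2r// ?nnegrE ?addr_ge0// /t lerD2l.
have z01 : 0 <= z <= 1 by rewrite z0 (le_trans z1)// ler_pdivrMr// mul1r ler_nat.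
have eaz : - z <= e * a <= z by rewrite ea1 ea2.
have T1 := powR_sub1_bound m2 z01 eaz.
have t20 : 0 <= t ^+ 2 by exact: sqr_ge0.
have := powR_shift_remainder m2 t20 D0.
rewrite !powR_sqr (ger0_norm t00) (_ : 2 * (m - 1) = 2 * m - 2); last by ring.
rewrite -/t -/E in T1 *.
set Y := (t ^+ 2 + D) `^ (m - 2) in Y1 *; set X := (t ^+ 2 + D) `^ m in dist *.
set T2 := t `^ (2 * m - 2) in T1 *; set T0 := t `^ (2 * m) in r2 *.
set B := _ `^ (m - 1) in dist bm.
move=> R2.
have C0 : 0 <= C by rewrite /C divr_ge0// !mulr_ge0.
have z3 : 0 <= z ^+ 3 by exact: exprn_ge0.
set M := m * (m - 1) * (2 * m - 1).
have M0 : 0 <= M by rewrite /M !mulr_ge0.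
have CM : C = 2 / 3 * M by rewrite /C /M; field.
have h1 : C * (z ^+ 3 * E) <= 2 / 3 * (20 / 11) * (M * z ^+ 3).
  have : M * z ^+ 3 * E <= M * z ^+ 3 * (20 / 11) by rewrite ler_wpM2l// mulr_ge0.
  rewrite CM; clear; lra.
have h2 : m * D * `|1 - T2| <= 2 * (20 / 11) * (M * z ^+ 3).
  have : m * D * `|1 - T2| <=
      m * ((2 * m - 1) * z ^+ 2) * ((2 * m - 2) * z * (20 / 11)).
    apply: ler_pM => //; first by rewrite mulr_ge0.
      by rewrite ler_wpM2l.
    by apply: (le_trans T1); rewrite ler_wpM2l// mulr_ge0.
  rewrite /M; clear; lra.
have h3 : m * (m - 1) * Y * D ^+ 2 <= 9 / 20 * (200 / 83) * (M * z ^+ 3).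
  have Y0 : 0 <= Y by exact: powR_ge0.
  have D2 : D ^+ 2 <= (2 * m - 1) * z ^+ 2 * (9 / 20 * z).
    rewrite expr2; apply: ler_pM => //; apply: (le_trans Dz).
    by rewrite expr2 mulrA ler_wpM2r.
  have : m * (m - 1) * Y * D ^+ 2 <=
      m * (m - 1) * (200 / 83) * ((2 * m - 1) * z ^+ 2 * (9 / 20 * z)).
    apply: ler_pM => //; rewrite ?sqr_ge0//.
      by rewrite !mulr_ge0.
    by rewrite ler_wpM2l// mulr_ge0.
  rewrite /M; clear; lra.
have tri : `|Q - X| <= C * (z ^+ 3 * E) + C * (z ^+ 3 * E) + m * D * `|1 - T2| +
    m * (m - 1) * Y * D ^+ 2.
  set A1 := Q - 1 - _ - _ in Qr; set A2 := T0 - 1 - _ - _ in r2.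
  set A3 := X - T0 - m * T2 * D in R2.
  have -> : Q - X = A1 - A2 + m * D * (1 - T2) - A3.
    by rewrite /A1 /A2 /A3 /D; ring.
  apply: (le_trans (ler_normB _ _)); apply: lerD; last first.
    by move/andP: R2 => [R0 R1]; rewrite ger0_norm.
  apply: (le_trans (ler_normD _ _)); apply: lerD; last first.
    by rewrite normrM ger0_norm// mulr_ge0.
  by apply: (le_trans (ler_normB _ _)); apply: lerD.
(* 717/100 rounds up (4/3) (20/11) + 2 (20/11) + (9/20) (200/83). Divided by 11/20 it stays below
   40/3, the growth rate in m of kappa / (2 m - 1). *)
have hm : m * (11 / 20) * `|P - (t ^+ 2 + D)| <= (717 / 100) * (M * z ^+ 3).
  have Mz : 0 <= M * z ^+ 3 by rewrite mulr_ge0.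
  have : m * (11 / 20) * `|P - (t ^+ 2 + D)| <= m * B * `|P - (t ^+ 2 + D)|.
    by rewrite ler_wpM2r// ler_wpM2l.
  clear -dist tri h1 h2 h3 Mz; lra.
have mp' : 0 < m * (11 / 20) by rewrite mulr_gt0// (lt_le_trans ltr01).
rewrite -(ler_pM2l mp'); apply: (le_trans hm).
have : 0 <= m * z ^+ 3 * ((m - 2) * (2 * m - 1)).
  by rewrite !mulr_ge0.
have : 0 <= m * z ^+ 3 * (2 * m - 1) by rewrite !mulr_ge0.
rewrite /M; clear; lra.
Qed.
End LargeExponent.

(** * Joining the ranges of eps *)

Lemma remainder_le_le4 (R : realType) (m e a L Q : R) : 1 < m <= 2 -> `|e| <= 1 ->
  a ^+ 2 <= 1 -> a ^+ 2 <= L -> L <= 2 * m - 1 -> 0 <= Q ->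
  (1 + e * a) ^+ 2 <= Q `^ m^-1 ->
  Q `^ m^-1 - 1 - 2 * (e * a) <= (2 * m - 1) * (`|e| ^+ 2 * (1 + `|e|) `^ (2 * m - 2)) ->
  `|Q - 1 - 2 * m * (e * a) - m * e ^+ 2 * (L + (2 * m - 2) * a ^+ 2)| <=
    2 * m * (`|e| `^ (m + 1) * (1 + `|e|) `^ (m - 1)) ->
  `|Q `^ m^-1 - 1 - 2 * (e * a) - L * e ^+ 2| <=
  16 * (2 * m - 1) / (2 * m * (2 * m + 2)) *
    (4 * (2 * m - 2) + (3 * (2 * m) / (2 * m - 2)) `^ (2 * m / 2 - 1)) * `|e| `^ (m + 1).
Proof.
move=> m12 e1 a1 aL Lm Q0 Plo Pup Qr; have hk := kappa_ge m12.
have [e4|/ltW e4] := leP `|e| (1 / 4); first exact: (remainder_fine_le4 m12 e4 a1 aL).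
have z1 : 1 / 4 <= `|e| <= 1 by rewrite e4 e1.
have /andP[lo hi] := remainder_crude e1 a1 aL Lm Plo Pup.
rewrite ler_norml; apply/andP; split; last first.
  exact: (le_trans hi (remainder_mid_le4 m12 z1 hk)).
apply: le_trans lo; rewrite lerN2; apply: le_trans (remainder_mid_le4 m12 z1 hk).
have /andP[m1 _] := m12.
rewrite ler_wpM2l//; first by lra.
by rewrite ler_peMr ?sqr_ge0// powR_ge1 ?lerDl//; lra.
Qed.

Lemma remainder_le_ge4 (R : realType) (m e a L Q : R) : 2 <= m -> `|e| <= 1 ->
  a ^+ 2 <= 1 -> a ^+ 2 <= L -> L <= 2 * m - 1 -> 0 <= Q ->
  (1 + e * a) ^+ 2 <= Q `^ m^-1 -> Q `^ m^-1 <= (1 + `|e|) ^+ 2 ->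
  Q `^ m^-1 - 1 - 2 * (e * a) <= (2 * m - 1) * (`|e| ^+ 2 * (1 + `|e|) `^ (2 * m - 2)) ->
  `|Q - 1 - 2 * m * (e * a) - m * e ^+ 2 * (L + (2 * m - 2) * a ^+ 2)| <=
    2 * m * (2 * m - 1) * (2 * m - 2) / 6 * (`|e| ^+ 3 * (1 + `|e|) `^ (2 * m - 3)) ->
  `|Q `^ m^-1 - 1 - 2 * (e * a) - L * e ^+ 2| <=
  4 / 3 * (5 * (2 * m) ^+ 2 - 12 * (2 * m) + 7) * `|e| ^+ 3.
Proof.
move=> m2 e1 a1 aL Lm Q0 Plo Pup2 Pup Qr.
have [x1|/ltW x1] := leP ((2 * m - 1) * `|e|) (9 / 20).
  exact: (remainder_fine_ge4 m2 x1 a1 aL).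
have /andP[lo hi] := remainder_crude e1 a1 aL Lm Plo Pup.
have z0 := normr_ge0 e; have ze := real_normK (num_real e).
have na : `|a| <= 1 by rewrite -(@ler_sqr _ `|a| 1) ?nnegrE// real_normK ?num_real// expr1n.
have nea : `|e * a| <= `|e| by rewrite normrM ler_piMr.
move: nea; rewrite ler_norml => /andP[ea1 ea2].
rewrite ler_norml; apply/andP; split.
  apply: le_trans lo; rewrite lerN2.
  set z := `|e| in z0 x1 e1 *; clear -m2 z0 x1.
  have h : 1 <= 4 / 3 * (10 * m - 7) * z.
    have : 0 <= (m - 2) * z by rewrite mulr_ge0//; lra.
    lra.
  have := ler_wpM2l (_ : 0 <= (2 * m - 1) * z ^+ 2) h.
  move=> /(_ _)/wrap[|]; last by lra.
  by rewrite mulr_ge0 ?sqr_ge0//; lra.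
have [x2|/ltW x2] := leP ((2 * m - 1) * `|e|) (5 / 6).
  exact: le_trans hi (remainder_mid_ge4 m2 z0 x1 x2).
apply: le_trans (remainder_far_ge4 m2 z0 x2).
have Le : a ^+ 2 * e ^+ 2 <= L * e ^+ 2 by rewrite ler_wpM2r ?sqr_ge0.
have h : (1 - `|e|) ^+ 2 <= (1 + e * a) ^+ 2 by rewrite lerXn2r// ?nnegrE; lra.
lra.
Qed.

(** L - a^2 = (p - 1) (c - a^2) + b, and L <= (p - 1) (c + b). *)
Lemma coefficient_bounds (R : realType) (m a b c : R)
    (L := - (2 * m - 2) * a ^+ 2 + (2 * m - 1) * c + b) :
  1 < m -> a ^+ 2 <= c -> 0 <= c -> 0 <= b -> c + b <= 1 ->
  [/\ a ^+ 2 <= 1, a ^+ 2 <= L & L <= 2 * m - 1].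
Proof.
move=> m1 ac c0 b0 cb1.
have : 0 <= (2 * m - 1) * (c - a ^+ 2) by rewrite mulr_ge0//; lra.
have : 0 <= (2 * m - 2) * a ^+ 2 by rewrite mulr_ge0 ?sqr_ge0//; lra.
have : 0 <= (2 * m - 2) * b by rewrite mulr_ge0//; lra.
have : 0 <= (2 * m - 1) * (1 - c - b) by rewrite mulr_ge0//; lra.
by split; rewrite /L; lra.
Qed.

Lemma normCE d (T : measurableType d) (R : realType) (mu : {measure set T -> \bar R})
    (p : R) (phi : (T -> R) * (T -> R)) :
  mu.-integrable setT (EFin \o (fun x => modulus phi x `^ p)) ->
  normC mu p phi = (\int[mu]_x (modulus phi x `^ p)) `^ p^-1.
Proof.
move=> ip; rewrite /normC unlock /=.
have -> : (\int[mu]_x (`|(modulus phi x)%:E| `^ p))%E =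
    (\int[mu]_x (modulus phi x `^ p))%:E.
  rewrite /Rintegral fineK; last exact: integrable_fin_num.
  apply: eq_integral => x _.
  by rewrite /= ger0_norm ?sqrtr_ge0.
by rewrite poweR_EFin.
Qed.

Theorem theorem2p1 (d : measure_display) (T : measurableType d) (R : realType)
    (mu : {measure set T -> \bar R}) (p : R) (hp : 2 < p)
    (f : T -> R) (psi : (T -> R) * (T -> R))
    (hf : LpC mu p (f, 0)) (hpsi : LpC mu p psi)
    (npsi : normC mu p psi = 1) (nf : normC mu p (f, 0) = 1)
    (kappa : R) (hkappa : is_kappa p kappa) (eps : R) :
  -1 <= eps <= 1 ->
  `| Ppsi mu p f psi eps - 1
     - 2 * pairing mu (duality p f) psi.1 * eps
     - pairingC mu (Lop mu p f psi) psi * eps ^+ 2 |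
  <= kappa * `|eps| `^ beta p.
Proof.
rewrite -ler_norml => e1.
have [m pE] : exists m, p = 2 * m by exists (p / 2); field.
move: hp hf hpsi npsi nf hkappa; rewrite {}pE {p} => hp [] /= hf _ [].
case: psi => xi eta /= hxi heta npsi nf hkappa.
have m1 : 1 < m by lra.
have m0 : 0 < m by lra.
have p1 : 1 <= 2 * m by lra.
have p0 : 2 * m != 0 by rewrite gt_eqF//; lra.
have mf : measurable_fun setT f by have := sub_Lfun_mfun hf; rewrite inE.
have mxi : measurable_fun setT xi by have := sub_Lfun_mfun hxi; rewrite inE.
have meta : measurable_fun setT eta by have := sub_Lfun_mfun heta; rewrite inE.
have modf x : modulus (f, 0) x = `|f x|.
  by rewrite /modulus/= expr0n addr0 sqrtr_sqr.
have iF : mu.-integrable setT (EFin \o (fun x => `|f x| `^ (2 * m))).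
  exact: Lfun_integrable.
have psiE x : Num.sqrt (xi x ^+ 2 + eta x ^+ 2) `^ (2 * m) =
    (xi x ^+ 2 + eta x ^+ 2) `^ m.
  rewrite -[X in X `^ _]ger0_norm ?sqrtr_ge0// -powR_sqr sqr_sqrtr//.
  by rewrite addr_ge0 ?sqr_ge0.
have iPsi : mu.-integrable setT
    (EFin \o (fun x => Num.sqrt (xi x ^+ 2 + eta x ^+ 2) `^ (2 * m))).
  (* The dominating function is 2^(p-1) (|xi|^p + |eta|^p); the bound is [modulus_powR_le] with i
     eta as the perturbation of xi and e = 1. *)
  have := @Rintegral_comb _ _ _ mu
    [:: ((1 + `|1|) `^ (2 * m - 1), fun x => `|xi x| `^ (2 * m));
    ((1 + `|1|) `^ (2 * m - 1), fun x => `|eta x| `^ (2 * m))].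
  case=> /=; first by split; [exact: Lfun_integrable|split; [exact: Lfun_integrable|]].
  under eq_fun do rewrite !big_cons big_nil /= addr0.
  move=> iS _; apply: (integrable_dominated _ iS).
    under eq_fun do rewrite psiE.
    by apply: measurable_powRT; apply: measurable_funD; exact: measurable_funX.
  move=> x; rewrite ger0_norm ?powR_ge0// psiE.
  have := modulus_powR_le 1 (xi x) 0 (eta x) m1.
  by rewrite mulr0 addr0 expr0n/= add0r sqrtr_sqr !mul1r normr1 mul1r mulrDr.
have norm1 phi : mu.-integrable setT (EFin \o (fun x => modulus phi x `^ (2 * m))) ->
    normC mu (2 * m) phi = 1 -> \int[mu]_x modulus phi x `^ (2 * m) = 1.
  move=> iphi; rewrite normCE// => /(congr1 (fun r => r `^ (2 * m))).
  rewrite -powRrM mulVf// powRr1 ?powR1//.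
  by apply: Rintegral_ge0 => x _; exact: powR_ge0.
have nF : \int[mu]_x `|f x| `^ (2 * m) = 1.
  under eq_Rintegral do rewrite -modf.
  by apply: norm1 => //; under eq_fun do rewrite modf.
have nPsi : \int[mu]_x Num.sqrt (xi x ^+ 2 + eta x ^+ 2) `^ (2 * m) = 1.
  exact: (norm1 (xi, eta)).
have [c00 e00] := second_order_terms_Rintegral_ge0 mu m f xi eta.
have ce1 := second_order_terms_Rintegral_le m1 mf mxi meta iF iPsi nF nPsi.
have ac := first_order_term_Rintegral_sqr m1 mf mxi iF iPsi nF.
have iA := integrable_first_order_term m1 mf mxi iF iPsi.
have iC := integrable_second_order_re m1 mf mxi iF iPsi.
have iE := integrable_second_order_im m1 mf meta iF iPsi.
have iH := integrable_modulus_powR m1 mf mxi meta iF iPsi eps.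
have PE : Ppsi mu (2 * m) f (xi, eta) eps =
    (\int[mu]_x ((f x + eps * xi x) ^+ 2 + (eps * eta x) ^+ 2) `^ m) `^ m^-1.
  have hE x : modulus ((f, 0) + eps *: (xi, eta)) x `^ (2 * m) =
      ((f x + eps * xi x) ^+ 2 + (eps * eta x) ^+ 2) `^ m.
    rewrite -[X in X `^ _]ger0_norm ?sqrtr_ge0// -powR_sqr sqr_sqrtr.
      by rewrite /= /GRing.scale /= /cst /= !add0r.
    by rewrite addr_ge0 ?sqr_ge0.
  rewrite /Ppsi normCE; last by under eq_fun do rewrite hE.
  under eq_Rintegral do rewrite hE.
  rewrite -powR_mulrn ?powR_ge0// -powRrM; congr (_ `^ _).
  by field; rewrite gt_eqF.
set a := \int[mu]_x (f x * `|f x| `^ (2 * m - 2) * xi x) in ac *.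
have aE : pairing mu (duality (2 * m) f) xi = a by [].
set c := \int[mu]_x (_ * xi x ^+ 2) in ac c00 ce1 *.
set b := \int[mu]_x (_ * eta x ^+ 2) in e00 ce1 *.
have LE : pairingC mu (Lop mu (2 * m) f (xi, eta)) (xi, eta) =
    - (2 * m - 2) * a ^+ 2 + (2 * m - 1) * c + b.
  rewrite /pairingC; congr (_ + _); last first.
    by apply: eq_Rintegral => x _; rewrite /= /Lim; ring.
  rewrite /pairing /= /Lre.
  have /(_ _)/wrap[/=//|[_]] := @Rintegral_comb _ _ _ mu
    [:: (- (2 * m - 2) * a, fun x => f x * `|f x| `^ (2 * m - 2) * xi x);
        (2 * m - 1, fun x => `|f x| `^ (2 * m - 2) * xi x ^+ 2)].
  rewrite !big_cons big_nil /= -/a -/c => cE.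
  rewrite (_ : - (2 * m - 2) * a ^+ 2 + (2 * m - 1) * c =
    - (2 * m - 2) * a * a + ((2 * m - 1) * c + 0)); last by ring.
  rewrite -cE; apply: eq_Rintegral => x _.
  by rewrite !big_cons big_nil /= -/a /duality; ring.
rewrite PE aE LE.
set L := - (2 * m - 2) * a ^+ 2 + _ + _.
set Q := \int[mu]_x (_ `^ m).
have Q0 : 0 <= Q by apply: Rintegral_ge0 => x _; exact: powR_ge0.
have [a1 aL Lm] := coefficient_bounds m1 ac c00 e00 ce1; rewrite -/L in aL Lm.
have na : `|a| <= 1 by rewrite -(@ler_sqr _ `|a| 1) ?nnegrE// real_normK ?num_real// expr1n.
have ea : `|eps * a| <= 1 by rewrite normrM mulr_ile1.
have t0 : 0 <= 1 + eps * a by move: ea; rewrite ler_norml => /andP[]; clear; lra.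
have mV : 0 <= m^-1 by rewrite invr_ge0 ltW.
have root_sqr x : 0 <= x -> (x `^ (2 * m)) `^ m^-1 = x ^+ 2.
  move=> x0; rewrite -powRrM -(powR_mulrn 2 x0); congr (_ `^ _).
  by field; rewrite gt_eqF.
have Plo : (1 + eps * a) ^+ 2 <= Q `^ m^-1.
  move: t0; rewrite le_eqVlt => /predU1P[<-|t0]; first by rewrite expr0n/= powR_ge0.
  rewrite -(root_sqr _ (ltW t0)) ge0_ler_powR ?nnegrE ?powR_ge0//.
  exact: modulus_Rintegral_ge.
have Pup2 : Q `^ m^-1 <= (1 + `|eps|) ^+ 2.
  rewrite -root_sqr ?addr_ge0// ge0_ler_powR ?nnegrE ?powR_ge0//.
  exact: modulus_Rintegral_le.
have Pup : Q `^ m^-1 - 1 - 2 * (eps * a) <=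
    (2 * m - 1) * (`|eps| ^+ 2 * (1 + `|eps|) `^ (2 * m - 2)).
  have := modulus_Rintegral_first_order m1 mf mxi meta iF iPsi nF nPsi eps.
  rewrite -/a -/Q (powR_mulrn 2 (normr_ge0 eps)); set B := _ * (1 + _) `^ _ => h.
  have V1 : 0 <= m^-1 <= 1 by rewrite mV invf_le1// ltW.
  (* Concavity of the m-th root at 1 carries the first order bound from Q to P, divided by m. *)
  have h2 : Q `^ m^-1 <= 1 + m^-1 * (Q - 1).
    move: Q0; rewrite le_eqVlt => /predU1P[<-|Q0]; last exact: powR_le_tangent.
    rewrite powR0 ?invr_eq0 ?gt_eqF// sub0r mulrN1 subr_ge0.
    by case/andP: V1.
  have h3 := ler_wpM2l mV h.
  have -> : (2 * m - 1) * B = m^-1 * (m * (2 * m - 1) * B) by field; rewrite gt_eqF.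
  apply: le_trans h3.
  have -> : m^-1 * (Q - 1 - 2 * m * (eps * a)) = m^-1 * (Q - 1) - 2 * (eps * a).
    by field; rewrite gt_eqF.
  by rewrite lerD2r lerBlDl.
(* Times m, this is the second order coefficient of Q and of P0^m alike; the term in a^2 comes from
   raising 1 + 2 a eps to the power m. *)
have bE : (2 * m - 1) * c + b = L + (2 * m - 2) * a ^+ 2 by rewrite /L; ring.
rewrite -[2 * a * eps]mulrA [a * eps]mulrC.
have main_le : m <= 2 ->
    `|Q `^ m^-1 - 1 - 2 * (eps * a) - L * eps ^+ 2| <=
    16 * (2 * m - 1) / (2 * m * (2 * m + 2)) *
    (4 * (2 * m - 2) + (3 * (2 * m) / (2 * m - 2)) `^ (2 * m / 2 - 1)) * `|eps| `^ (m + 1).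
  move=> m2; apply: remainder_le_le4 => //; first by rewrite m1.
  rewrite -bE; exact: modulus_Rintegral_second_order_le4.
case: hkappa => [[m4 ->]|[/andP[_ m4] ->]].
  have m2 : 2 <= m by clear -m4; lra.
  rewrite /beta m4 (powR_mulrn 3 (normr_ge0 eps)).
  apply: remainder_le_ge4 => //.
  rewrite -bE -(powR_mulrn 3 (normr_ge0 eps)).
  exact: modulus_Rintegral_second_order_ge4.
have m2 : m <= 2 by clear -m4; lra.
rewrite (_ : beta (2 * m) = m + 1); first exact: main_le.
(* At p = 4 [beta] takes its first branch, and 3 = m + 1 because m = 2. *)
rewrite /beta; case: ifPn => [m4'|_]; last by field.
by clear -m4 m4'; lra.
Qed.
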